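(* Let $m\ge2$ and let $\mathcal{H}\in\mathcal{P}(\mathcal{H})$ be a connected $3$-cyclic Type II linear $m$-uniform hypergraph with $k$ edges. Then: (i) $\lambda_1(\mathcal{H})\le\lambda_1(T_2C(c_1=k-9))$, and equality holds only when $\mathcal{H}=T_2C(c_1=k-9)$. (ii) $\lambda_1(T_2C(c_1=k-9))=\gamma/(m-1)$ and $\gamma<\dfrac{m+4+\sqrt{(m+4)^2+4(k-3)(m-1)}}{2}$, where $\gamma$ is the root with the largest modulus of the polynomial (in $\lambda$) $$\big(\lambda^2-(m-2)\lambda-2m+3\big)\Big((\lambda-m+3)\big(\lambda(\lambda-m+2)-(k-3)(m-1)+6\big)+6(m-2)\Big)-6(\lambda+1)^2(\lambda-m+2).$$
   Context: A hypergraph has a finite vertex set and an edge set of non-empty subsets of the vertex set; it is $m$-uniform if all edges have cardinality $m$, and linear if two distinct edges share at most one vertex. The adjacency matrix of a linear $m$-uniform hypergraph has $(i,j)$ entry $\frac{1}{m-1}$ if $i\ne j$ lie in a common edge, and $0$ otherwise; $\lambda_1$ denotes the spectral radius of this matrix. The $m$-th power hypergraph of a graph $G(V,E)$ is the $m$-uniform hypergraph obtained by adding to each edge $e\in E$ $m-2$ new vertices $v_{e,1},\dots,v_{e,m-2}$ (distinct for distinct edges). $\mathcal{P}(\mathcal{H})$ denotes the set of $m$-th power hypergraphs of graphs (a fixed notation for the set, not depending on the particular hypergraph $\mathcal{H}$). A loose cycle of length $l\ge3$, $v_1e_1v_2e_2\dots v_le_lv_1$, is the $m$-uniform hypergraph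 with edges $e_1,\dots,e_l$ in which $e_{i-1}\cap e_i=\{v_i\}$ (indices mod $l$, the $v_i$ distinct) and non-consecutive edges are disjoint. A linear hypergraph is $3$-cyclic if it contains exactly three loose cycles. An $m$-uniform $3$-cyclic linear hypergraph with $n$ vertices and $k$ edges is of Type II if $n=k(m-1)-2$. Attaching a pendant edge at a vertex $v$ means adding a new edge consisting of $v$ and $m-1$ new vertices. $T_2C(c_1=l_1,\dots,c_7=l_7)$ is the hypergraph consisting of three loose cycles of length $3$, $v_1e_1v_2e_2v_3e_3v_1$, $v_1e_4v_4e_5v_5e_6v_1$ and $v_1e_7v_6e_8v_7e_9v_1$, pairwise sharing only the vertex $v_1$, together with $l_i$ pendant edges attached at $v_i$ for $i=1,\dots,7$; when only some of the $c_i$ are listed, the others are $0$. Equality of hypergraphs means isomorphism. *)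

(* Defs.v *)
From mathcomp Require Import all_boot all_order all_algebra.

Set Implicit Arguments.
Unset Strict Implicit.
Unset Printing Implicit Defensive.

Import Order.TTheory GRing.Theory Num.Theory.

Record hypergraph := Hypergraph {
  vert : finType;
  edges : {set {set vert}};
  edges_neq0 : set0 \notin edges }.

Definition isomorphic (H1 H2 : hypergraph) : Prop :=
  exists2 f : vert H1 -> vert H2, bijective f &
    [set f @: (e : {set vert H1}) | e in edges H1] = edges H2.

Definition uniform (m : nat) (H : hypergraph) : Prop :=
  forall e, e \in edges H -> #|e| = m.

Definition linear_hypergraph (H : hypergraph) : Prop :=
  forall e f, e \in edges H -> f \in edges H -> e != f -> #|e :&: f| <= 1.

Definition adjacent (H : hypergraph) : rel (vert H) :=
  fun x y => (x != y) && [exists e in edges H, (x \in e) && (y \in e)].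

Definition hconnected (H : hypergraph) : Prop :=
  forall x y : vert H, connect (@adjacent H) x y.

(* A loose cycle contained in H is identified with its set C of edges; the
   v_i and the cyclic order of the edges are determined by C up to rotation
   and reflection. Indices are taken cyclically in 'I_l, and the edge e i
   joins v i to v (ordS i). *)
Definition loose_cycle (H : hypergraph) (C : {set {set vert H}}) : Prop :=
  exists (l : nat) (v : 'I_l -> vert H) (e : 'I_l -> {set vert H}),
    [/\ 3 <= l, injective v,
        (forall i, e (ord_pred i) :&: e i = [set v i]),
        (forall i j, j != i -> j != ordS i -> i != ordS j ->
           [disjoint e i & e j])
      & C = [set e i | i : 'I_l] /\ C \subset edges H].

Definition three_cyclic (H : hypergraph) : Prop :=
  exists2 S : {set {set {set vert H}}}, #|S| = 3 &
    forall C, C \in S <-> loose_cycle C.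

(* n = k(m-1) - 2, with n and k the numbers of vertices and edges. *)
Definition type_II (m : nat) (H : hypergraph) : Prop :=
  #|vert H| + 2 = #|edges H| * (m - 1).

Section Power.
Variables (m : nat) (G : hypergraph).

Definition power_vert : finType :=
  (vert G + {e : {set vert G} | e \in edges G} * 'I_(m - 2))%type.

Definition power_edge (e : {e : {set vert G} | e \in edges G}) :
    {set power_vert} :=
  [set inl x | x in val e] :|: [set inr (e, t) | t : 'I_(m - 2)].

Definition power_edges : {set {set power_vert}} :=
  [set power_edge e | e : {e : {set vert G} | e \in edges G}].

Fact power_edges_neq0 : set0 \notin power_edges.
Proof.
apply/imsetP => -[[e eG] _ e0].
have [e_eq0|[x xe]] := set_0Vmem e.
  by have := edges_neq0 G; rewrite -e_eq0 eG.
have : inl x \in power_edge (exist _ e eG).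
  by rewrite inE; apply/orP; left; apply: imset_f.
by rewrite -e0 inE.
Qed.

Definition power : hypergraph := Hypergraph power_edges_neq0.

End Power.

(* Finite simple graphs are the 2-uniform hypergraphs. *)
Definition power_hypergraph (m : nat) (H : hypergraph) : Prop :=
  exists2 G : hypergraph, uniform 2 G & isomorphic H (power m G).

Section T2C.
Variables (m : nat) (l : 'I_7 -> nat).

(* v_1, ..., v_7 are numbered from 0; each of the nine cycle edges has m-2
   further vertices; the p-th pendant edge at v_i has m-1 new vertices. *)
Definition T2C_vert : finType :=
  ('I_7 + ('I_9 * 'I_(m - 2) + {i : 'I_7 & 'I_(l i) * 'I_(m - 1)}))%type.

Definition T2C_ends : seq (nat * nat) :=
  [:: (1, 2); (2, 3); (3, 1); (1, 4); (4, 5); (5, 1); (1, 6); (6, 7); (7, 1)].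

Definition T2C_v (i : nat) : T2C_vert := inl (inord i.-1).

Definition T2C_cycle_edge (j : 'I_9) : {set T2C_vert} :=
  let ab := nth (0, 0) T2C_ends j in
  [set T2C_v ab.1; T2C_v ab.2] :|: [set inr (inl (j, t)) | t : 'I_(m - 2)].

Definition T2C_pendant_edge (ip : {i : 'I_7 & 'I_(l i)}) : {set T2C_vert} :=
  inl (tag ip) |:
    [set inr (inr (Tagged (fun i => 'I_(l i) * 'I_(m - 1))%type
                          (tagged ip, t))) | t : 'I_(m - 1)].

Definition T2C_edges : {set {set T2C_vert}} :=
  [set T2C_cycle_edge j | j : 'I_9] :|:
  [set T2C_pendant_edge ip | ip : {i : 'I_7 & 'I_(l i)}].

Fact T2C_edges_neq0 : set0 \notin T2C_edges.
Proof.
rewrite inE; apply/norP; split; apply/imsetP => -[j _ /setP e0].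
  have := e0 (T2C_v (nth (0, 0) T2C_ends j).1).
  by rewrite !inE eqxx.
by have := e0 (inl (tag j)); rewrite !inE eqxx.
Qed.

Definition T2C : hypergraph := Hypergraph T2C_edges_neq0.

End T2C.

Definition only_c1 (a : nat) : 'I_7 -> nat :=
  fun i => if i == ord0 then a else 0.

Local Open Scope ring_scope.

(* C stands for the field of complex numbers. Its order is the partial order
   of a numClosedFieldType, in which x <= y means that y - x is a nonnegative
   real; it is only applied to real quantities. *)
Definition adjacency_matrix (C : numClosedFieldType) (m : nat)
    (H : hypergraph) : 'M[C]_#|vert H| :=
  \matrix_(i, j)
    if adjacent (enum_val i) (enum_val j) then (m%:R - 1)^-1 else 0.

Definition spectrum (C : numClosedFieldType) (n : nat) (A : 'M[C]_n) : seq C :=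
  sval (closed_field_poly_normal (char_poly A)).

Definition spectral_radius (C : numClosedFieldType) (n : nat) (A : 'M[C]_n) :
    C :=
  \big[Num.max/0]_(a <- spectrum A) `|a|.

Lemma mem_spectrum (C : numClosedFieldType) (n : nat) (A : 'M[C]_n) (a : C) :
  (a \in spectrum A) = eigenvalue A a.
Proof.
rewrite eigenvalue_root_char /spectrum.
case: closed_field_poly_normal => r /= ->.
by rewrite (monicP (char_poly_monic A)) scale1r root_prod_XsubC.
Qed.

Definition lambda1 (C : numClosedFieldType) (m : nat) (H : hypergraph) : C :=
  spectral_radius (adjacency_matrix C m H).

Definition gamma_poly (C : numClosedFieldType) (m k : nat) : {poly C} :=
  let M : {poly C} := m%:R in
  let K : {poly C} := k%:R in
  ('X ^+ 2 - (M - 2) * 'X - 2 * M + 3)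
    * (('X - M + 3) * ('X * ('X - M + 2) - (K - 3) * (M - 1) + 6)
       + 6 * (M - 2))
  - 6 * ('X + 1) ^+ 2 * ('X - M + 2).

Definition largest_modulus_root (C : numClosedFieldType) (p : {poly C})
    (z : C) : Prop :=
  root p z /\ forall w, root p w -> w != z -> `|w| < `|z|.

(* Main.v *)
(* Write H as the power of a graph G.  Being connected with two more edges than
   vertices, G has exactly three chords with respect to any breadth-first
   spanning tree.  If two chords shared a vertex w, the tree paths between their
   other ends would avoid w and close up to a further cycle, so that there would
   be at least four cycles; hence the chords are pairwise disjoint, and none of
   them contains the root.

   Take a positive Perron vector x of H and root the tree at the vertex c of G
   where x is largest.  Moving the parent end of every tree edge to c does not
   decrease the quadratic form of x, and produces T_2C(c_1 = k - 9): a star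
   centred at c together with three disjoint chords.  Equality makes x a Perron
   vector of both hypergraphs, and comparing the rows of c shows that every
   parent already was c.

   For (ii), the sums of the Perron vector over the classes of equivalent
   vertices solve a system of five linear equations whose determinant is the
   given polynomial.  Conversely a root z of maximal modulus gives an explicit
   z-eigenvector; its modulus is a Perron vector, so its phase is constant on
   the neighbours of a chord end, which forces z to be the spectral radius. *)
Require Import Defs.
From mathcomp Require Import all_boot all_order all_algebra.
From mathcomp Require Import ring zify.
Set Implicit Arguments.
Unset Strict Implicit.
Unset Printing Implicit Defensive.
Import Order.TTheory GRing.Theory Num.Theory.

(** * Isomorphisms and powers of graphs *)

Lemma adjacent_sym (H : hypergraph) : symmetric (@adjacent H).
Proof.
move=> x y; rewrite /adjacent eq_sym; congr (_ && _).
by apply: eq_existsb => e; rewrite [(_ \in e) && _]andbC.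
Qed.

Lemma isomorphic_sym H1 H2 : isomorphic H1 H2 -> isomorphic H2 H1.
Proof.
case=> f [g fK gK] fE; exists g; first by exists f.
rewrite -fE -imset_comp -[RHS]imset_id; apply: eq_imset => e /=.
by rewrite -imset_comp (eq_imset _ fK) imset_id.
Qed.

Lemma isomorphic_trans H1 H2 H3 :
  isomorphic H1 H2 -> isomorphic H2 H3 -> isomorphic H1 H3.
Proof.
case=> f f_bij fE [g g_bij gE]; exists (g \o f); first exact: bij_comp.
by rewrite -gE -fE -imset_comp; apply: eq_imset => e /=; rewrite imset_comp.
Qed.

Lemma adjacent_isomorphic H1 H2 (f : vert H1 -> vert H2) :
  bijective f -> [set f @: (e : {set vert H1}) | e in edges H1] = edges H2 ->
  forall x y, adjacent (f x) (f y) = adjacent x y.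
Proof.
move=> f_bij fE x y; have f_inj := bij_inj f_bij.
rewrite /adjacent (inj_eq f_inj); congr (_ && _).
apply/exists_inP/exists_inP => [[e] | [e eH]].
  rewrite -fE => /imsetP[e' e'H ->]; rewrite !mem_imset // => xy.
  by exists e'.
by move=> xy; exists (f @: e); [rewrite -fE imset_f | rewrite !mem_imset].
Qed.

Lemma hconnected_isomorphic H1 H2 :
  isomorphic H1 H2 -> hconnected H1 -> hconnected H2.
Proof.
case=> f f_bij fE conn1 x y; have adjE := adjacent_isomorphic f_bij fE.
have [g fK gK] := f_bij; rewrite -(gK x) -(gK y).
have /connectP[p p_path ->] := conn1 (g x) (g y).
apply/connectP; exists (map f p); last by rewrite last_map.
by rewrite path_map; apply: sub_path p_path => u v /=; rewrite adjE.
Qed.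

Lemma ordS_neq n (i : 'I_n) : 1 < n -> ordS i != i.
Proof.
move=> n_gt1; rewrite -(inj_eq val_inj) /=; case: i => i /= i_lt.
have [lt_n|] := ltnP i.+1 n; first by rewrite modn_small //; lia.
move=> le_n; have e : i.+1 = n by lia.
by rewrite e modnn; lia.
Qed.

Lemma ordS2_neq n (i : 'I_n) : 2 < n -> ordS (ordS i) != i.
Proof.
move=> n_gt2; rewrite -(inj_eq val_inj) /= -addn1 modnDml addn1.
case: i => i /= i_lt; have [lt_n|] := ltnP i.+2 n.
  by rewrite modn_small //; lia.
rewrite leq_eqVlt => /predU1P[e|]; first by rewrite -e modnn; lia.
move=> le_n; have e : i.+2 = 1 + n by lia.
by rewrite e modnDr modn_small; lia.
Qed.

(** * Cycles of a graph and loose cycles of its power *)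

Section Cycles.
Variables (m : nat) (G : hypergraph).
Hypothesis G_graph : uniform 2 G.

Lemma adjacent_edge (x y : vert G) :
  adjacent x y = (x != y) && ([set x; y] \in edges G).
Proof.
rewrite /adjacent; have [//|xy] /= := eqVneq x y.
apply/exists_inP/idP => [[e eG /andP[xe ye]] | xyG]; last first.
  by exists [set x; y]; rewrite // !inE !eqxx orbT.
suff -> : [set x; y] = e by [].
by apply/eqP; rewrite eqEcard subUset !sub1set xe ye (G_graph eG) cards2 xy.
Qed.

Lemma set2_edge (x y : vert G) : [set x; y] \in edges G -> x != y.
Proof. by move/G_graph; rewrite cards2; case: eqP. Qed.

Definition power_lift (D : {set {set vert G}}) : {set {set vert (power m G)}} :=
  [set power_edge m e | e : {e | e \in edges G} & val e \in D].

Lemma inl_power_edge x (e : {e | e \in edges G}) :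
  (inl x \in power_edge m e) = (x \in val e).
Proof.
rewrite inE mem_imset; last by move=> ? ? [].
by case: imsetP => [[t _ //]|]; rewrite orbF.
Qed.

Lemma inr_power_edge e' t (e : {e | e \in edges G}) :
  (inr (e', t) \in power_edge m e) = (e' == e).
Proof.
rewrite inE; case: imsetP => [[x _ //]|_] /=.
apply/imsetP/eqP => [[t' _ [-> _]] // | ->]; by exists t.
Qed.

Lemma power_edge_inj : injective (@power_edge m G).
Proof.
move=> e f ef; apply: val_inj; apply/setP => x.
by rewrite -!inl_power_edge ef.
Qed.

Lemma mem_power_lift D e : (power_edge m e \in power_lift D) = (val e \in D).
Proof. by rewrite mem_imset ?inE //; apply: power_edge_inj. Qed.

(** A power edge determines its graph edge. The inclusions are there because [power_lift] sees only
    members of [edges G]. *)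
Lemma power_lift_inj (D D' : {set {set vert G}}) : D \subset edges G -> D' \subset edges G ->
  power_lift D = power_lift D' -> D = D'.
Proof.
move=> sD sD' eqD; apply/setP => e.
have [eG|eG] := boolP (e \in edges G).
  by rewrite -!(mem_power_lift _ (exist _ e eG)) eqD.
by rewrite (contraNF (subsetP sD e)) // (contraNF (subsetP sD' e)).
Qed.

Definition cycle_edges (s : seq (vert G)) : {set {set vert G}} :=
  [set [set x; next s x] | x in s].

Lemma cycle_edges_sub s : cycle (@adjacent G) s -> cycle_edges s \subset edges G.
Proof.
move=> s_cyc; apply/subsetP => _ /imsetP[x xs ->].
by have := next_cycle s_cyc xs; rewrite adjacent_edge => /andP[].
Qed.

Lemma next_nth_mod (x0 : vert G) s i : uniq s -> i < size s ->
  next s (nth x0 s i) = nth x0 s (i.+1 %% size s).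
Proof.
case: s => // y s s_uniq i_lt; rewrite next_nth mem_nth // index_uniq //.
have [lt_i|le_i] := ltnP i (size s).
  by rewrite modn_small //=; apply: set_nth_default.
have -> : i = size s by move: i_lt le_i => /=; lia.
by rewrite modnn nth_default.
Qed.

(** Each added vertex lies on a single power edge, so two power edges meet only in the graph
    vertices they share; a length of at least three keeps consecutive edges of the cycle
    distinct. *)
Lemma power_cycle s : ucycle (@adjacent G) s -> 3 <= size s ->
  loose_cycle (H := power m G) (power_lift (cycle_edges s)).
Proof.
case/andP => s_cyc s_uniq s_size.
have x0 : vert G by case: s s_size {s_cyc s_uniq} => [|x ?] .
pose u (i : 'I_(size s)) := nth x0 s i.
have u_inj : injective u.
  by move=> i j /eqP; rewrite nth_uniq // => /eqP/val_inj.
have uS i : next s (u i) = u (ordS i) by rewrite /u next_nth_mod.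
have us i : u i \in s by rewrite mem_nth.
have uG i : [set u i; u (ordS i)] \in edges G.
  by apply: (subsetP (cycle_edges_sub s_cyc)); rewrite -uS; apply: imset_f.
pose ue i : {e | e \in edges G} := Sub [set u i; u (ordS i)] (uG i).
have Sneq (i : 'I_(size s)) : ordS i != i by apply: ordS_neq; apply: ltnW.
have SSneq (i : 'I_(size s)) : ordS (ordS i) != i by apply: ordS2_neq.
have ue_neq i j : i != j -> u i != u j by rewrite (inj_eq u_inj).
exists (size s), (fun i => inl (u i)), (fun i => power_edge m (ue i)).
split=> // [i j [] /u_inj //|i|i j ji jSi iSj|].
(* With [i] written as a successor, the two edges start at [j] and at [ordS j]. A common added
   vertex would identify them, forcing [j] to be [ordS j] or its second successor. *)
- have [j ->] : exists j, i = ordS j by exists (ord_pred i); rewrite ord_predK.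
  rewrite ordSK; apply/setP => -[x|[e t]]; last first.
    rewrite in_setI !inr_power_edge in_set1 /=; apply/andP => -[/eqP e1 /eqP].
    rewrite e1 => /(congr1 val) /setP/(_ (u j)); rewrite !inE eqxx !(inj_eq u_inj).
    case/esym/orP.
      by rewrite eq_sym (negPf (Sneq j)).
    by rewrite eq_sym (negPf (SSneq j)).
  rewrite in_setI !inl_power_edge in_set1 !inE /=.
  rewrite (inj_eq (@inl_inj _ _)).
  have [->|x_neq] := eqVneq x (u (ordS j)); first by rewrite orbT.
  rewrite orbF; have [->|//] := eqVneq x (u j).
  by rewrite (inj_eq u_inj) eq_sym (negPf (SSneq j)).
- rewrite -setI_eq0; apply/eqP/setP => -[x|[e t]]; rewrite in_setI in_set0.
    rewrite !inl_power_edge !inE /=.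
    apply/andP => -[/orP[]/eqP-> /orP[]]; rewrite (inj_eq u_inj).
    + by rewrite eq_sym (negPf ji).
    + by rewrite (negPf iSj).
    + by rewrite eq_sym (negPf jSi).
    + by rewrite (inj_eq (@ordS_inj _)) eq_sym (negPf ji).
  rewrite !inr_power_edge.
  apply/andP => -[/eqP e1 /eqP]; rewrite e1 => /(congr1 val) /setP/(_ (u i)).
  rewrite !inE eqxx !(inj_eq u_inj) /= => /esym/orP[].
    by rewrite eq_sym (negPf ji).
  by rewrite (negPf iSj).
split; last first.
  by apply/subsetP => _ /imsetP[e _ ->]; apply: imset_f.
apply/setP => X; apply/imsetP/imsetP => [[e]|[i _ ->]].
  rewrite inE => /imsetP[x xs eE] ->.
  have x_lt : index x s < size s by rewrite index_mem.
  exists (Ordinal x_lt) => //; congr power_edge; apply: val_inj.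
  by rewrite /= -uS /u /= nth_index.
by exists (ue i); rewrite // inE /= -uS; apply: imset_f.
Qed.

End Cycles.

(** * Breadth-first trees and their chords *)

Lemma loose_cycle_isomorphic H1 H2 (f : vert H1 -> vert H2)
    (D : {set {set vert H1}}) :
  bijective f -> [set f @: (e : {set vert H1}) | e in edges H1] = edges H2 ->
  loose_cycle D -> loose_cycle [set f @: (e : {set vert H1}) | e in D].
Proof.
move=> f_bij fE [l [v [e [l_ge3 v_inj vE e_disj [DE DH]]]]].
have f_inj := bij_inj f_bij.
exists l, (f \o v), (fun i => f @: e i); split=> //.
- exact: inj_comp.
- by move=> i; rewrite -imsetI ?vE ?imset_set1 //; apply: in2W.
- by move=> i j ji jSi iSj; rewrite imset_disjoint ?e_disj.
split; first by rewrite DE -imset_comp.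
by rewrite -fE imsetS.
Qed.

(** Transport back along the isomorphism is injective on edge sets and lands in the three-element
    set of loose cycles. This turns any explicit list of four distinct cycles into a
    contradiction. *)
Lemma three_cyclic_isomorphic H1 H2 (s : seq {set {set vert H2}}) :
  isomorphic H1 H2 -> three_cyclic H1 -> uniq s ->
  {in s, forall D, loose_cycle D} -> size s <= 3.
Proof.
move=> /isomorphic_sym[f f_bij fE] [S <- SP] s_uniq s_cyc.
pose h (D : {set {set vert H2}}) := [set f @: (e : {set vert H2}) | e in D].
have h_inj : injective h by do 2!apply: imset_inj; apply: bij_inj.
rewrite -(size_map h) -(card_uniqP _) ?map_inj_uniq //.
apply/subset_leq_card/subsetP => _ /mapP[D /s_cyc Dcyc ->].
exact/SP/loose_cycle_isomorphic.
Qed.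

Section BreadthFirstTree.
Variable G : hypergraph.
Hypotheses (G_graph : uniform 2 G) (G_conn : hconnected G).
Variable c : vert G.

(** Walks are quantified as tuples of fixed length, which makes the predicate boolean, as [ex_minn]
    requires. *)
Let walk_ex v : exists n, [exists t : n.-tuple (vert G),
  path (@adjacent G) c t && (last c t == v)].
Proof.
have /connectP[p p_path pv] := G_conn c v.
by exists (size p); apply/existsP; exists (in_tuple p); rewrite p_path -pv /=.
Qed.

Definition dist (v : vert G) : nat := ex_minn (walk_ex v).

Lemma dist_walk v :
  exists2 p, path (@adjacent G) c p & last c p = v /\ size p = dist v.
Proof.
rewrite /dist; case: ex_minnP => n /existsP[t /andP[tp /eqP tv]] _.
by exists t; rewrite ?size_tuple.
Qed.

Lemma dist_le p : path (@adjacent G) c p -> dist (last c p) <= size p.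
Proof.
rewrite /dist => p_path; case: ex_minnP => n _; apply; apply/existsP.
by exists (in_tuple p); rewrite p_path /=.
Qed.

Lemma dist_adjacent u v : adjacent u v -> dist v <= (dist u).+1.
Proof.
move=> uv; have [p p_path [pu <-]] := dist_walk u.
have := @dist_le (rcons p v); rewrite last_rcons size_rcons; apply.
by rewrite rcons_path p_path pu.
Qed.

Lemma dist_root : dist c = 0.
Proof. by apply/eqP; rewrite -leqn0 (@dist_le [::]). Qed.

Lemma dist_predecessor v : v != c ->
  exists u, adjacent v u && (dist v == (dist u).+1).
Proof.
move=> v_neq; have [p p_path [pv sz]] := dist_walk v.
case/lastP: p => [|p u] in p_path pv sz *; first by rewrite -pv eqxx in v_neq.
move: p_path pv sz; rewrite rcons_path last_rcons size_rcons.
case/andP=> p_path pu uv sz; rewrite uv in pu; exists (last c p).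
rewrite adjacent_sym pu eqn_leq dist_adjacent // -sz ltnS.
by rewrite dist_le.
Qed.

(** Any neighbour one step nearer to [c] serves. At [c] there is none, so the default gives
    [parent c = c]. *)
Definition parent (v : vert G) : vert G :=
  odflt c [pick u | adjacent v u && (dist v == (dist u).+1)].

Lemma parentP v : v != c -> adjacent v (parent v) /\ dist v = (dist (parent v)).+1.
Proof.
move=> /dist_predecessor[u uP]; rewrite /parent.
by case: pickP => [w /andP[? /eqP]|/(_ u)] //; rewrite uP.
Qed.

Definition tree_edges : {set {set vert G}} :=
  [set [set v; parent v] | v in [set~ c]].

Definition chords : {set {set vert G}} := edges G :\: tree_edges.

(** Two different vertices with the same tree edge would be parents of each other, each strictly
    nearer to [c] than the other. *)
Lemma tree_edge_inj : {in [set~ c] &, injective (fun v => [set v; parent v])}.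
Proof.
move=> u v; rewrite !inE => /parentP[_ du] /parentP[_ dv] /setP uv.
have := uv u; have := uv v; rewrite !inE !eqxx /= => vu /esym uv'.
apply/eqP; case/orP: uv' => // /eqP u_pv; case/orP: vu => [/eqP->//|/eqP v_pu].
by move: du dv; rewrite -u_pv -v_pu => -> ?; lia.
Qed.

Lemma tree_edges_sub : tree_edges \subset edges G.
Proof.
apply/subsetP => _ /imsetP[v + ->]; rewrite !inE => /parentP[+ _].
by rewrite adjacent_edge // => /andP[].
Qed.

Lemma card_tree_edges : #|tree_edges| = #|vert G|.-1.
Proof. by rewrite card_in_imset ?cardsC1 //; apply: tree_edge_inj. Qed.

Lemma card_chords : #|chords| = #|edges G| - #|vert G|.-1.
Proof.
rewrite -card_tree_edges cardsD (setIidPr _) //; exact: tree_edges_sub.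
Qed.

Definition tree_step : rel (vert G) := fun x y =>
  (x != c) && (y == parent x) || (y != c) && (x == parent y).

Lemma tree_step_sym : symmetric tree_step.
Proof. by move=> x y; rewrite /tree_step orbC. Qed.

Lemma tree_stepP x y : tree_step x y -> [set x; y] \in tree_edges.
Proof.
case/orP=> /andP[nc /eqP->]; first by apply/imsetP; exists x; rewrite ?inE.
by rewrite setUC; apply/imsetP; exists y; rewrite ?inE.
Qed.

(** Tree steps missing [w]: a path of such steps between two neighbours of [w] closes up through [w]
    to a cycle. *)
Definition avoiding (w : vert G) : rel (vert G) := fun x y =>
  [&& tree_step x y, x != w & y != w].

Lemma avoiding_sym w : symmetric (avoiding w).
Proof. by move=> x y; rewrite /avoiding tree_step_sym [(x != w) && _]andbC. Qed.

(* The tree path from u to c leaves u through the parent of u, and its later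
   vertices are closer to c than w, so it does not meet w. *)
Lemma chord_connect w u : [set w; u] \in chords ->
  [/\ w != c, u != w & connect (avoiding w) u c].
Proof.
rewrite inE => /andP[wuT wuG]; have wu := set2_edge G_graph wuG.
have wu_adj : adjacent w u by rewrite adjacent_edge // wu.
have dwu := dist_adjacent wu_adj.
have dist0 x : dist x = 0 -> x = c.
  by move=> dx; apply/eqP/negPn/negP => /parentP[_]; rewrite dx.
have w_neq : w != c.
  (* A chord at [c] would end at a vertex at distance one, whose parent is [c], and so would be a
     tree edge. *)
  apply: contraNneq wuT => wc.
  have uc : u != c by rewrite -wc eq_sym.
  have pu : parent u = c.
    by apply: dist0; have [_ du] := parentP uc; move: dwu; rewrite wc dist_root; lia.
  by rewrite wc setUC -pu; apply: imset_f; rewrite !inE.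
split=> //; first by rewrite eq_sym.
(* From a vertex other than [w] and no farther than [w], the parent is strictly nearer to [c] than
   [w], so the descent never meets [w]. *)
have descend n x : dist x <= n -> x != w -> dist x <= dist w ->
    connect (avoiding w) x c.
  elim: n x => [|n IHn] x; first by rewrite leqn0 => /eqP/dist0->.
  move=> dx xw dxw; have [->//|xc] := eqVneq x c.
  have [_ dp] := parentP xc.
  have pw : parent x != w by apply: contraTneq dxw => <-; rewrite dp; lia.
  apply: connect_trans (IHn (parent x) _ pw _); [|lia..].
  by apply: connect1; rewrite /avoiding /tree_step xc eqxx xw.
have [le_d|lt_d] := leqP (dist u) (dist w).
  by apply: (descend _ u (leqnn _) _ le_d); rewrite eq_sym.
have uc : u != c by apply: contraTneq lt_d => ->; rewrite dist_root.
have [_ dp] := parentP uc.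
have pw : parent u != w.
  apply: contraNneq wuT => <-; rewrite setUC; apply: imset_f.
  by rewrite !inE.
apply: connect_trans (descend _ (parent u) (leqnn _) pw _); last by lia.
by apply: connect1; rewrite /avoiding /tree_step uc eqxx pw (eq_sym u w) wu.
Qed.


Lemma next_last (u : vert G) q : uniq (u :: q) -> next (u :: q) (last u q) = u.
Proof. by move=> uq; rewrite next_nth mem_last index_last ?nth_default. Qed.

(** Cycles will be told apart by their traces on the chords. When every edge of [s] lies in the tree
    or in [F], the trace cannot exceed [F]. *)
Lemma cycle_chords (F : {set {set vert G}}) s : F \subset chords ->
  F \subset cycle_edges s ->
  cycle (fun x y => [set x; y] \in tree_edges :|: F) s ->
  cycle (@adjacent G) s /\ cycle_edges s :&: chords = F.
Proof.
move=> FN Fs s_cyc; split.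
  apply: sub_cycle s_cyc => x y xyF; have xyG : [set x; y] \in edges G.
    case/setUP: xyF => [/(subsetP tree_edges_sub)|/(subsetP FN)] //.
    by rewrite inE => /andP[].
  by rewrite adjacent_edge // (set2_edge G_graph xyG).
apply/eqP; rewrite eqEsubset subsetI Fs FN !andbT.
apply/subsetP => _ /setIP[/imsetP[x xs ->]]; rewrite inE => /andP[xT _].
by have := next_cycle s_cyc xs; rewrite inE (negPf xT).
Qed.

(** The fundamental cycle of a chord: the tree path between its ends, closed by the chord. A path of
    a single step would make the chord a tree edge, so the length is at least three. *)
Lemma chord_cycle e : e \in chords -> exists s,
  [/\ ucycle (@adjacent G) s, 3 <= size s & cycle_edges s :&: chords = [set e]].
Proof.
move=> eN; have /setDP[eG eT] := eN.
have /eqP/cards2P[w [u [wu eE]]] := G_graph eG.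
rewrite {}eE in eN eG eT *.
have sub_tree z : subrel (avoiding z) tree_step by move=> x y /and3P[].
have [_ _ uc] := chord_connect eN.
have [_ _ wc] : [/\ u != c, w != u & connect (avoiding u) w c].
  by apply: chord_connect; rewrite setUC.
have connT z x y : connect (avoiding z) x y -> connect tree_step x y.
  apply: connect_sub => {}x {}y /sub_tree; exact: connect1.
have : connect tree_step w u.
  apply: connect_trans (connT _ _ _ wc) _.
  by rewrite (sym_connect_sym tree_step_sym) (connT _ _ _ uc).
case/connectP=> p0 p0_path; case/shortenP: p0_path => q q_path q_uniq _ uE.
have [] := @cycle_chords [set [set w; u]] (w :: q).
- by rewrite sub1set.
- rewrite sub1set; apply/imsetP; exists (last w q); first exact: mem_last.
  by rewrite next_last // -uE setUC.
- rewrite /cycle rcons_path -uE [[set u; w]]setUC !inE eqxx orbT andbT.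
  by apply: sub_path q_path => x y /tree_stepP; rewrite inE => ->.
move=> cyc trace; exists (w :: q); split=> //; first by rewrite /ucycle cyc.
case: q q_path uE {q_uniq cyc trace} => [_ uw|y [/= /andP[wy _] uy|//]].
  by rewrite uw eqxx in wu.
by move/tree_stepP: wy; rewrite -uy (negPf eT).
Qed.

(** The far ends of both chords reach [c] in the tree without meeting [w], hence reach each other;
    the resulting path closes through [w] along the two chords. *)
Lemma chord_cycle2 w u1 u2 : [set w; u1] \in chords -> [set w; u2] \in chords ->
  u1 != u2 -> exists s,
  [/\ ucycle (@adjacent G) s, 3 <= size s
    & cycle_edges s :&: chords = [set [set w; u1]; [set w; u2]]].
Proof.
move=> N1 N2 u12; have [_ wu1 c1] := chord_connect N1.
have [_ wu2 c2] := chord_connect N2.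
have : connect (avoiding w) u1 u2.
  apply: connect_trans c1 _; rewrite (sym_connect_sym (avoiding_sym w)).
  exact: c2.
case/connectP=> p0 p0_path; case/shortenP: p0_path => q q_path q_uniq _ u2E.
have wq : w \notin u1 :: q.
  rewrite inE eq_sym (negPf wu1) /=.
  elim: q u1 q_path {N1 u12 wu1 c1 q_uniq u2E} => //= y q IHq u1 /andP[/and3P[_ _ yw]].
  by move/IHq; rewrite inE negb_or eq_sym yw.
have s_uniq : uniq [:: w, u1 & q] by rewrite cons_uniq wq.
have nx : next [:: w, u1 & q] u2 = w by rewrite u2E; apply: (next_last s_uniq).
have [] := @cycle_chords [set [set w; u1]; [set w; u2]] [:: w, u1 & q].
- by rewrite subUset !sub1set N1.
- rewrite subUset !sub1set; apply/andP; split; apply/imsetP.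
    by exists w; rewrite ?mem_head //= eqxx.
  exists u2; first by rewrite u2E in_cons mem_last orbT.
  by rewrite nx setUC.
- rewrite /cycle rcons_path /= -u2E [[set u2; w]]setUC !inE !eqxx !orbT andbT.
  apply: sub_path q_path => x y /and3P[/tree_stepP + _ _].
  by rewrite inE => ->.
move=> cyc trace; exists [:: w, u1 & q]; split=> //.
  by rewrite /ucycle cyc.
by case: q u2E {q_path q_uniq wq s_uniq cyc trace nx} => // u12'; rewrite u12' eqxx in u12.
Qed.

(** If [e] and [f] met and [g] were a third chord, there would be cycles with traces {e}, {f}, {g}
    and {e, f}, hence four loose cycles in the power. *)
Lemma chords_disjoint m H : isomorphic H (power m G) -> three_cyclic H ->
  2 < #|chords| -> {in chords &, forall e f : {set vert G}, e != f -> [disjoint e & f]}.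
Proof.
move=> isoH cycH chords_gt2 e f eN fN ef; apply/negPn/negP => /pred0Pn[w /=].
case/andP=> we wf.
have other g : g \in chords -> w \in g -> exists u, g = [set w; u].
  move=> /setDP[/G_graph/eqP/cards2P[x [y [xy ->]]] _]; rewrite !inE.
  case/orP=> /eqP->; [by exists y | by exists x; rewrite setUC].
have [u1 e1] := other e eN we; have [u2 f2] := other f fN wf.
have [g gN] : exists2 g, g \in chords & g \notin [set e; f].
  apply/subsetPn; apply: contraL chords_gt2 => /subset_leq_card.
  by rewrite cards2 ef -leqNgt.
have u12 : u1 != u2 by apply: contraNneq ef => u12; rewrite e1 f2 u12.
rewrite !inE negb_or => /andP[ge gf].
have [s1 [cyc1 sz1 t1]] := chord_cycle eN.
have [s2 [cyc2 sz2 t2]] := chord_cycle fN.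
have [s3 [cyc3 sz3 t3]] := chord_cycle gN.
rewrite e1 f2 in eN fN; have [s4 [cyc4 sz4 t4]] := chord_cycle2 eN fN u12.
rewrite -e1 -f2 in t4.
pose ss := [:: s1; s2; s3; s4].
have lift_neq s t h : ucycle (@adjacent G) s -> ucycle (@adjacent G) t ->
    (h \in cycle_edges s :&: chords) != (h \in cycle_edges t :&: chords) ->
  power_lift m (cycle_edges s) != power_lift m (cycle_edges t).
  move=> /andP[cs _] /andP[ct _]; apply: contra_neqN => /eqP st.
  by rewrite (power_lift_inj _ _ st) // cycle_edges_sub.
have lift_cyc s : ucycle (@adjacent G) s -> 3 <= size s ->
    loose_cycle (power_lift m (cycle_edges s)).
  exact: power_cycle.
pose L := [seq power_lift m (cycle_edges s) | s <- ss].
suff L_uniq : uniq L.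
  have := three_cyclic_isomorphic isoH cycH L_uniq.
  rewrite size_map /= => L_le; have : 4 <= 3; last by [].
  by apply: L_le => D; rewrite !inE => /or4P[] /eqP->; apply: lift_cyc.
rewrite /= !inE !negb_or.
(* For each pair the third argument is a chord lying in exactly one of the two traces. *)
rewrite (lift_neq _ _ e cyc1 cyc2) ?(lift_neq _ _ g cyc1 cyc3)
  ?(lift_neq _ _ f cyc1 cyc4) ?(lift_neq _ _ g cyc2 cyc3)
  ?(lift_neq _ _ e cyc2 cyc4) ?(lift_neq _ _ g cyc3 cyc4) //.
all: rewrite ?t1 ?t2 ?t3 ?t4 !inE ?eqxx ?(eq_sym f e) ?(negPf ef) ?(negPf ge) ?(negPf gf) //.
Qed.

End BreadthFirstTree.

Local Open Scope ring_scope.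

(** * The spectral radius of a hypergraph *)

(** The order is only partial, so the maximum is handled through comparability of nonnegative
    elements. *)
Lemma bigmax_norm (R : numDomainType) (s : seq R) :
  0 <= \big[Num.max/0]_(a <- s) `|a| /\
  forall b, b \in s -> `|b| <= \big[Num.max/0]_(a <- s) `|a|.
Proof.
elim: s => [|a s [ge0 ub]]; first by rewrite big_nil.
rewrite big_cons.
have cmp : (`|a| >=< \big[Num.max/0]_(a <- s) `|a|)%O.
  by rewrite real_comparable ?ger0_real.
split; first by rewrite comparable_le_max ?normr_ge0.
move=> b; rewrite inE comparable_le_max // => /predU1P[->|/ub ->].
  by rewrite lexx.
by rewrite orbT.
Qed.

Lemma bigmax_norm_attained (R : numDomainType) (a : R) (s : seq R) :
  exists2 b, b \in a :: s & `|b| = \big[Num.max/0]_(c <- a :: s) `|c|.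
Proof.
elim: s a => [|b s IHs] a.
  exists a; rewrite ?mem_head // big_cons big_nil.
  by rewrite comparable_maxEge ?normr_ge0 // real_comparable ?ger0_real.
rewrite big_cons; have [c c_in cE] := IHs b; rewrite -cE.
rewrite /Num.max /=; case: ifP => _; last by exists a; rewrite ?mem_head.
by exists c; rewrite // inE c_in orbT.
Qed.

(** * Rayleigh quotients of Hermitian matrices *)

Section SpectralRadius.
Local Open Scope sesquilinear_scope.
Variables (C : numClosedFieldType) (n : nat) (A : 'M[C]_n).

Lemma eigenvalue_le_spectral_radius a :
  eigenvalue A a -> `|a| <= spectral_radius A.
Proof. by rewrite -mem_spectrum => /(bigmax_norm _).2. Qed.

Lemma spectral_radius_eigenvalue : (0 < n)%N ->
  exists2 a, eigenvalue A a & `|a| = spectral_radius A.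
Proof.
move=> /eigenvalue_closed -/(_ _ A) [a]; rewrite -mem_spectrum.
have memP := @mem_spectrum C n A.
rewrite /spectral_radius; case: (spectrum A) memP => // b s memP _.
by have [c c_in cE] := bigmax_norm_attained b s; exists c; rewrite -?memP.
Qed.

Hypothesis A_herm : A \is hermsymmx.

Let P := spectralmx A.
Let d := spectral_diag A.

Let A_eq : A = P ^t* *m diag_mx d *m P.
Proof.
rewrite -invmx_unitary ?spectral_unitarymx //.
exact/orthomx_spectralP/hermitian_normalmx.
Qed.

Let PP : P *m P ^t* = 1%:M.
Proof. exact/unitarymxP/spectral_unitarymx. Qed.

Let PP' : P ^t* *m P = 1%:M.
Proof. exact: mulmx1C. Qed.

Let d_eig i : eigenvalue A (d 0 i).
Proof.
apply/eigenvalueP; exists (row i P).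
  rewrite -row_mul A_eq !mulmxA PP mul1mx; apply/rowP => j.
  by rewrite mul_diag_mx !mxE.
apply/negP => /eqP /(congr1 (fun u => (u *m P ^t*) 0 i)).
by rewrite -row_mul PP mul0mx !mxE eqxx => /eqP; rewrite oner_eq0.
Qed.

Let d_le i : d 0 i <= spectral_radius A.
Proof.
have d_real : d 0 i \is Num.real.
  by have /mxOverP := hermitian_spectral_diag_real A_herm; apply.
by apply: le_trans (eigenvalue_le_spectral_radius (d_eig i)); apply: real_ler_norm.
Qed.

Let coordE (x : 'rV[C]_n) : (x *m P ^t*) ^t* = P *m x ^t*.
Proof. by rewrite trmx_mul map_mxM /= trmxCK. Qed.

(** The entries of [x *m P ^t*] are the coordinates of [x] in an orthonormal eigenbasis, where the
    norm and the form are both diagonal. *)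
Let normE (x : 'rV[C]_n) :
  (x *m x ^t*) 0 0 = \sum_i `|(x *m P ^t*) 0 i| ^+ 2.
Proof.
rewrite -[x in X in X *m _]mulmx1 -PP' mulmxA -mulmxA -coordE mxE.
by apply: eq_bigr => i _; rewrite normCK !mxE.
Qed.

Let formE (x : 'rV[C]_n) :
  (x *m A *m x ^t*) 0 0 = \sum_i d 0 i * `|(x *m P ^t*) 0 i| ^+ 2.
Proof.
rewrite A_eq !mulmxA -mulmxA -coordE mxE.
by apply: eq_bigr => i _; rewrite mul_mx_diag normCK !mxE mulrCA mulrA.
Qed.

Lemma hermsymmx_rayleigh (x : 'rV[C]_n) :
  (x *m A *m x ^t*) 0 0 <= spectral_radius A * (x *m x ^t*) 0 0.
Proof.
rewrite normE formE mulr_sumr; apply: ler_sum => i _.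
by rewrite ler_wpM2r ?exprn_ge0.
Qed.

(** Equality annihilates every nonnegative term of the difference, so [x] has nonzero coordinates
    only along eigenvectors whose eigenvalue is the spectral radius. *)
Lemma hermsymmx_rayleigh_eq (x : 'rV[C]_n) :
  (x *m A *m x ^t*) 0 0 = spectral_radius A * (x *m x ^t*) 0 0 ->
  x *m A = spectral_radius A *: x.
Proof.
rewrite normE formE mulr_sumr => eq_sum.
set y := x *m P ^t* in eq_sum.
have y_eig i : d 0 i * y 0 i = spectral_radius A * y 0 i.
  have [->|y_neq0] := eqVneq (y 0 i) 0; first by rewrite !mulr0.
  congr (_ * _); apply/esym/eqP; rewrite -subr_eq0.
  have /psumr_eq0P/(_ _ i isT)/eqP :
      forall i, true -> 0 <= (spectral_radius A - d 0 i) * `|y 0 i| ^+ 2.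
    by move=> j _; rewrite mulr_ge0 ?exprn_ge0 ?subr_ge0.
  rewrite mulf_eq0 expf_eq0 normr_eq0 (negPf y_neq0) orbF; apply.
  by under eq_bigr do rewrite mulrBl; rewrite sumrB -eq_sum subrr.
have yD : y *m diag_mx d = spectral_radius A *: y.
  by apply/rowP => i; rewrite mul_mx_diag mxE [RHS]mxE mulrC y_eig.
rewrite [in LHS]A_eq !mulmxA -/y yD -scalemxAl /y -mulmxA PP'.
by rewrite mulmx1.
Qed.

End SpectralRadius.

(** * Neighbour sums and Perron vectors *)

Section AdjacencySum.
Local Open Scope sesquilinear_scope.
Variables (C : numClosedFieldType) (m : nat) (H : hypergraph).

(** This is the action of the adjacency matrix multiplied by m - 1, on functions of vertices rather
    than on indexed rows; its spectral radius is accordingly [r], that is m - 1 times [lambda1]. *)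
Definition nbr_sum (x : vert H -> C) (v : vert H) : C :=
  \sum_(u | adjacent v u) x u.

Hypothesis m_ge2 : (2 <= m)%N.

Let A := adjacency_matrix C m H.
Let r : C := (m%:R - 1) * lambda1 C m H.
Let row_of (x : vert H -> C) : 'rV[C]_#|vert H| := \row_i x (enum_val i).

Lemma uniformity_gt0 : 0 < m%:R - 1 :> C.
Proof. by rewrite subr_gt0 ltr1n. Qed.

Let A_sum x : (m%:R - 1) *: (row_of x *m A) = row_of (nbr_sum x).
Proof.
apply/rowP => i; rewrite !mxE /nbr_sum mulr_sumr [RHS]big_mkcond.
rewrite (reindex _ (onW_bij _ (@enum_val_bij (vert H)))) /=.
apply: eq_bigr => j _; rewrite !mxE adjacent_sym.
case: ifP => _; last by rewrite !mulr0.
by rewrite mulrC divfK // gt_eqF ?uniformity_gt0.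
Qed.

Let eig_row z x : (forall v, nbr_sum x v = z * x v) ->
  row_of x *m A = (z / (m%:R - 1)) *: row_of x.
Proof.
move=> xz; have m_neq0 : m%:R - 1 != 0 :> C by rewrite gt_eqF ?uniformity_gt0.
apply: (scalerI m_neq0); rewrite A_sum scalerA mulrC divfK //.
by apply/rowP => i; rewrite !mxE xz.
Qed.

Let row_of_neq0 x v : x v != 0 -> row_of x != 0.
Proof.
apply: contra => /eqP/rowP/(_ (enum_rank v)).
by rewrite !mxE enum_rankK => ->.
Qed.

Let A_herm : A \is hermsymmx.
Proof.
apply: realsym_hermsym; last first.
  apply/mxOverP => i j; rewrite mxE; case: ifP => _; last exact: real0.
  by rewrite ger0_real // invr_ge0 ltW ?uniformity_gt0.
apply/is_hermitianmxP; rewrite expr0 scale1r; apply/matrixP => i j.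
by rewrite !mxE adjacent_sym.
Qed.

Lemma eigenvalue_le_lambda1 z x v :
  x v != 0 -> (forall u, nbr_sum x u = z * x u) -> `|z| <= r.
Proof.
move=> xv /eig_row xA; have : eigenvalue A (z / (m%:R - 1)).
  by apply/eigenvalueP; exists (row_of x); rewrite ?(row_of_neq0 xv).
move/eigenvalue_le_spectral_radius.
rewrite normrM normfV (gtr0_norm uniformity_gt0) ler_pdivrMr ?uniformity_gt0 //.
by rewrite mulrC.
Qed.

Lemma lambda1_ge0 : 0 <= r.
Proof. by rewrite mulr_ge0 ?(bigmax_norm _).1 // ltW ?uniformity_gt0. Qed.

Section Nonnegative.
Variable x : vert H -> C.
Hypothesis x_ge0 : forall v, 0 <= x v.

Let row_real : row_of x ^t* = (row_of x)^T.
Proof. by apply/matrixP => i j; rewrite !mxE geC0_conj. Qed.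

Let sqE : (row_of x *m row_of x ^t*) 0 0 = \sum_v x v ^+ 2.
Proof.
rewrite row_real mxE (reindex _ (onW_bij _ (@enum_val_bij (vert H)))) /=.
by apply: eq_bigr => i _; rewrite !mxE.
Qed.

Let formE :
  (m%:R - 1) * (row_of x *m A *m row_of x ^t*) 0 0 = \sum_v x v * nbr_sum x v.
Proof.
rewrite row_real; transitivity ((row_of (nbr_sum x) *m (row_of x)^T) 0 0).
  by rewrite -A_sum -scalemxAl [RHS]mxE.
rewrite mxE (reindex _ (onW_bij _ (@enum_val_bij (vert H)))) /=.
by apply: eq_bigr => i _; rewrite !mxE mulrC.
Qed.

Lemma nbr_sum_rayleigh : \sum_v x v * nbr_sum x v <= r * \sum_v x v ^+ 2.
Proof.
rewrite -formE -sqE -mulrA ler_pM2l ?uniformity_gt0 //.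
exact: hermsymmx_rayleigh A_herm _.
Qed.

Lemma nbr_sum_rayleigh_eq :
  \sum_v x v * nbr_sum x v = r * \sum_v x v ^+ 2 ->
  forall v, nbr_sum x v = r * x v.
Proof.
rewrite -formE -sqE -mulrA => /(mulfI _) eqA v.
have {eqA}/(hermsymmx_rayleigh_eq A_herm) xA := eqA (lt0r_neq0 uniformity_gt0).
have := A_sum x; rewrite xA scalerA => /rowP/(_ (enum_rank v)).
by rewrite !mxE enum_rankK => <-.
Qed.

(** Pairing the inequality with the nonnegative [x] reverses the Rayleigh bound, so the equality
    case applies. *)
Lemma nbr_sum_subharmonic_eq :
  (forall v, r * x v <= nbr_sum x v) -> forall v, nbr_sum x v = r * x v.
Proof.
move=> le_x; apply: nbr_sum_rayleigh_eq; apply/eqP.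
rewrite eq_le nbr_sum_rayleigh mulr_sumr ler_sum // => v _.
by rewrite expr2 mulrCA ler_wpM2l.
Qed.

End Nonnegative.

(** By the triangle inequality the moduli satisfy the subharmonic inequality. *)
Lemma norm_eigenvector z x : `|z| = r -> (forall v, nbr_sum x v = z * x v) ->
  forall v, nbr_sum (fun u => `|x u|) v = r * `|x v|.
Proof.
move=> zr xz; apply: nbr_sum_subharmonic_eq => // v.
by rewrite -zr -normrM -xz ler_norm_sum.
Qed.

(** Take the moduli of an eigenvector whose eigenvalue has the largest modulus. *)
Lemma perron_vector (v0 : vert H) :
  exists x, [/\ forall v, 0 <= x v, exists v, x v != 0
             & forall v, nbr_sum x v = r * x v].
Proof.
have n_gt0 : (0 < #|vert H|)%N by apply/card_gt0P; exists v0.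
have [a /eigenvalueP[y yA y_neq0] aE] := spectral_radius_eigenvalue A n_gt0.
pose x v := y 0 (enum_rank v).
have yE : y = row_of x by apply/rowP => i; rewrite mxE /x enum_valK.
have xz v : nbr_sum x v = ((m%:R - 1) * a) * x v.
  have := A_sum x; rewrite -yE yA scalerA => /rowP/(_ (enum_rank v)).
  by rewrite !mxE enum_rankK => <-.
exists (fun v => `|x v|); split=> // [|v].
  have /rV0Pn[i y_i] := y_neq0.
  by exists (enum_val i); rewrite normr_eq0 /x enum_valK.
apply: (norm_eigenvector _ xz).
by rewrite normrM aE gtr0_norm ?uniformity_gt0.
Qed.

(** A zero spreads to all neighbours, since a vanishing sum of nonnegative terms has only zero
    terms, and then along walks to every vertex. *)
Lemma perron_vector_gt0 x : hconnected H ->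
  (forall v, 0 <= x v) -> (exists v, x v != 0) ->
  (forall v, nbr_sum x v = r * x v) -> forall v, 0 < x v.
Proof.
move=> H_conn x_ge0 [v0 xv0] xr v; rewrite lt_def x_ge0 andbT.
apply: contra xv0 => xv; have /connectP[p] := H_conn v v0.
elim: p v xv => [|u p IHp] v xv /=; first by move=> _ ->.
case/andP => vu /IHp; apply.
have := xr v; rewrite (eqP xv) mulr0 => /psumr_eq0P -> //.
Qed.

End AdjacencySum.

Lemma nbr_sum_isomorphic (C : numClosedFieldType) H1 H2
    (f : vert H1 -> vert H2) (x : vert H2 -> C) v :
  bijective f -> [set f @: (e : {set vert H1}) | e in edges H1] = edges H2 ->
  nbr_sum (fun u => x (f u)) v = nbr_sum x (f v).
Proof.
move=> f_bij fE; rewrite /nbr_sum (reindex f) /=; last exact: onW_bij.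
by apply: eq_bigl => u; rewrite (adjacent_isomorphic f_bij fE).
Qed.

Lemma lambda1_isomorphic (C : numClosedFieldType) m H1 H2 :
  (2 <= m)%N -> vert H1 -> isomorphic H1 H2 -> lambda1 C m H1 = lambda1 C m H2.
Proof.
move=> m_ge2 v0 iso12.
have le H H' : vert H -> isomorphic H H' -> lambda1 C m H <= lambda1 C m H'.
  move=> v1 /isomorphic_sym[g g_bij gE].
  have [x [_ [v xv] xr]] := perron_vector C m_ge2 v1.
  have [f fK gK] := g_bij.
  have : x (g (f v)) != 0 by rewrite gK.
  move=> /(eigenvalue_le_lambda1 m_ge2 (x := x \o g)).
  rewrite -(ler_pM2l (uniformity_gt0 C m_ge2)) => /(_ ((m%:R - 1) * lambda1 C m H)).
  rewrite ger0_norm ?lambda1_ge0 //; apply=> u.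
  by rewrite [LHS](nbr_sum_isomorphic _ _ g_bij gE) xr.
have [f _ _] := iso12; apply/eqP; rewrite eq_le le //=.
by apply: le (f v0) (isomorphic_sym iso12).
Qed.

(** * Powers of graphs with indexed edges *)

(* The (q+2)-th power of the graph with edges {a i, b i}, with the edges indexed
   by I so that two such graphs on V can be compared edge by edge. *)
Section Thick.
Variables (V I : finType) (a b : I -> V) (q : nat).

Definition thick_vert : finType := (V + I * 'I_q)%type.

Definition thick_edge (i : I) : {set thick_vert} :=
  [set inl (a i); inl (b i)] :|: [set inr (i, t) | t : 'I_q].

Fact thick_edges_neq0 : set0 \notin [set thick_edge i | i : I].
Proof.
apply/imsetP => -[i _ /setP/(_ (inl (a i)))].
by rewrite !inE eqxx.
Qed.

Definition thick : hypergraph := Hypergraph thick_edges_neq0.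

Lemma inl_thick_edge v i : (inl v \in thick_edge i) = (v == a i) || (v == b i).
Proof.
rewrite inE [X in _ || X](_ : _ = false) ?orbF; last by apply/imsetP => -[].
by rewrite !inE.
Qed.

Lemma inr_thick_edge j t i : (inr (j, t) \in thick_edge i) = (j == i).
Proof.
rewrite inE !inE; apply/imsetP/eqP => [[s _ [-> _]] // | ->].
by exists t.
Qed.

Hypothesis ab_neq : forall i, a i != b i.

Lemma sum_thick_edge (R : nmodType) (F : thick_vert -> R) i :
  \sum_(u in thick_edge i) F u =
  F (inl (a i)) + F (inl (b i)) + \sum_t F (inr (i, t)).
Proof.
rewrite /thick_edge -setUA !big_setU1 /=.
- by rewrite addrA big_imset //= => s t _ _ [].
- by apply/imsetP => -[].
- rewrite !inE (inj_eq (@inl_inj _ _)) negb_or ab_neq.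
  by apply/imsetP => -[].
Qed.

Hypothesis ab_inj : injective (fun i => [set a i; b i]).

(** This is linearity: an added vertex names its own edge, and two graph vertices determine the edge
    by [ab_inj]. *)
Lemma thick_edge_unique u v i j : u != v -> u \in thick_edge i ->
  v \in thick_edge i -> u \in thick_edge j -> v \in thick_edge j -> i = j.
Proof.
case: u v => [u|[i' t]] [v|[j' s]]; rewrite ?inl_thick_edge ?inr_thick_edge;
  do ?[by move=> _ _ /eqP<- _ /eqP]; try by move=> _ /eqP<- _ /eqP.
rewrite (inj_eq (@inl_inj _ _)) => uv ui vi uj vj; apply: ab_inj.
have pairE k : (u == a k) || (u == b k) -> (v == a k) || (v == b k) ->
    [set a k; b k] = [set u; v].
  move=> /orP[]/eqP eu /orP[]/eqP ev; move: uv; rewrite eu ev ?eqxx // => _.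
  exact: setUC.
by rewrite (pairE i) ?(pairE j).
Qed.

(** By linearity each neighbour of [v] lies on exactly one edge through [v], so summing edge by edge
    counts it once. *)
Lemma nbr_sum_thick (C : numClosedFieldType) (x : thick_vert -> C) v :
  nbr_sum (H := thick) x v =
  \sum_(i | v \in thick_edge i)
     (x (inl (a i)) + x (inl (b i)) + \sum_t x (inr (i, t)) - x v).
Proof.
have edgeE i : v \in thick_edge i ->
    x (inl (a i)) + x (inl (b i)) + \sum_t x (inr (i, t)) - x v =
    \sum_(u | (u != v) && (u \in thick_edge i)) x u.
  move=> vi; rewrite -sum_thick_edge (bigD1 v) //= (addrC (x v)) addrK.
  by apply: eq_bigl => u; rewrite andbC.
rewrite (eq_bigr _ edgeE).
rewrite (exchange_big_dep (fun u => u != v)) /=; last by move=> i u _ /andP[].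
rewrite /nbr_sum big_mkcond [RHS]big_mkcond; apply: eq_bigr => u _.
rewrite {1}/adjacent eq_sym; case: eqVneq => //= uv.
case: exists_inP => [[_ /imsetP[i _ ->] /andP[vi ui]] | no_edge]; last first.
  rewrite big1 // => i /andP[vi ui]; case: no_edge.
  by exists (thick_edge i); rewrite ?imset_f // vi.
rewrite (big_pred1 i) // => j /=; apply/andP/eqP => [[vj uj]|->//].
exact: (thick_edge_unique uv).
Qed.

Lemma nbr_sum_thick_inr (C : numClosedFieldType) (x : thick_vert -> C) i t :
  nbr_sum (H := thick) x (inr (i, t)) =
  x (inl (a i)) + x (inl (b i)) + \sum_t x (inr (i, t)) - x (inr (i, t)).
Proof.
by rewrite nbr_sum_thick (big_pred1 i) // => j; rewrite inr_thick_edge eq_sym.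
Qed.

Lemma nbr_sum_thick_inl (C : numClosedFieldType) (x : thick_vert -> C) v :
  nbr_sum (H := thick) x (inl v) =
  \sum_(i | (v == a i) || (v == b i))
     (x (inl (a i)) + x (inl (b i)) + \sum_t x (inr (i, t)) - x (inl v)).
Proof.
by rewrite nbr_sum_thick; apply: eq_bigl => i; rewrite inl_thick_edge.
Qed.

Lemma thick_form (C : numClosedFieldType) (x : thick_vert -> C) :
  \sum_v x v * nbr_sum (H := thick) x v =
  \sum_i ((x (inl (a i)) + x (inl (b i)) + \sum_t x (inr (i, t))) ^+ 2
          - (x (inl (a i)) ^+ 2 + x (inl (b i)) ^+ 2
             + \sum_t x (inr (i, t)) ^+ 2)).
Proof.
under eq_bigr => v _ do rewrite nbr_sum_thick mulr_sumr.
rewrite (exchange_big_dep predT) //=; apply: eq_bigr => i _.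
rewrite -(sum_thick_edge (fun u => x u ^+ 2)) -sum_thick_edge.
rewrite expr2 mulr_suml -sumrB; apply: eq_bigr => u _.
by rewrite expr2 mulrBr.
Qed.

End Thick.

(** The forms are compared edge by edge with all values of [x] kept: raising one end from B to B'
    adds twice (A + W) times (B' - B), where W is the total on the added vertices. *)
Lemma thick_form_le (C : numClosedFieldType) (V I : finType) (a b b' : I -> V)
    q (x : V + I * 'I_q -> C) :
  (forall i, a i != b i) -> injective (fun i => [set a i; b i]) ->
  (forall i, a i != b' i) -> injective (fun i => [set a i; b' i]) ->
  (forall v, 0 <= x v) -> (forall i, x (inl (b i)) <= x (inl (b' i))) ->
  \sum_v x v * nbr_sum (H := thick a b q) x v <=
  \sum_v x v * nbr_sum (H := thick a b' q) x v.
Proof.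
move=> ab ab_inj ab' ab'_inj x_ge0 xb; rewrite !thick_form //.
apply: ler_sum => i _; rewrite -subr_ge0.
have sqdiff (A B B' W S : C) :
    (A + B' + W) ^+ 2 - (A ^+ 2 + B' ^+ 2 + S)
    - ((A + B + W) ^+ 2 - (A ^+ 2 + B ^+ 2 + S)) = 2 * (A + W) * (B' - B).
  by ring.
rewrite sqdiff.
by rewrite !mulr_ge0 ?subr_ge0 ?addr_ge0 ?sumr_ge0.
Qed.

(** That [f] fixes graph vertices lets a maximum over them survive the transport of a vector. *)
Lemma power_thick m q (G : hypergraph) (I : finType) (a b : I -> vert G)
    (h : I -> {e : {set vert G} | e \in edges G}) :
  q = (m - 2)%N -> bijective h -> (forall i, val (h i) = [set a i; b i]) ->
  exists f : vert (thick a b q) -> vert (power m G),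
  [/\ bijective f, forall v, f (inl v) = inl v
    & [set f @: (e : {set _}) | e in edges (thick a b q)]
      = edges (power m G)].
Proof.
move=> -> h_bij hE; have [g hK gK] := h_bij.
pose f (v : thick_vert (vert G) I (m - 2)) : power_vert m G :=
  match v with inl x => inl x | inr it => inr (h it.1, it.2) end.
have f_bij : bijective f.
  exists (fun v => match v with inl x => inl x | inr et => inr (g et.1, et.2) end).
    by case=> [x|[i t]] //=; rewrite hK.
  by case=> [x|[e t]] //=; rewrite gK.
exists f; split=> //; have fE i : f @: thick_edge a b (m - 2) i = power_edge m (h i).
  have [f' fK f'K] := f_bij.
  apply/setP => v; rewrite -(f'K v) mem_imset; last exact: bij_inj.
  case: (f' v) => [x|[j t]]; rewrite /= ?inl_thick_edge ?inr_thick_edge.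
    rewrite inE mem_imset; last exact: inl_inj.
    rewrite hE !inE [X in _ = _ || X](_ : _ = false) ?orbF //.
    by apply/imsetP => -[].
  rewrite inE [X in X || _](_ : _ = false) /=; last by apply/imsetP => -[].
  apply/eqP/imsetP => [->|[s _ [/(bij_inj h_bij)]]] //.
  by exists t.
rewrite -imset_comp; apply/setP => e; apply/imsetP/imsetP => [[i _ ->]|[i _ ->]].
  by exists (h i); rewrite //= fE.
by exists (g i); rewrite //= fE gK.
Qed.

(** * A star with three chords *)

Section Star.
Local Open Scope nat_scope.
Variables (V : finType) (c : V) (al be : 'I_3 -> V).

(** A tree edge is indexed by its child end and a chord by its number. Replacing [p] by the constant
    [c] then turns the tree into the star over the same index type, so edges correspond. *)
Definition tree_index : finType := ({v : V | v != c} + 'I_3)%type.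

Definition child (i : tree_index) : V :=
  match i with inl v => val v | inr j => al j end.

Definition base (p : V -> V) (i : tree_index) : V :=
  match i with inl v => p (val v) | inr j => be j end.

Hypotheses (al_neq : forall j, al j != c) (be_neq : forall j, be j != c).
Hypotheses (al_inj : injective al) (be_inj : injective be).
Hypothesis al_be : forall i j, al i != be j.

Let center : V -> V := fun=> c.

Lemma star_neq i : child i != base center i.
Proof. by case: i => [[v vc]|j] /=. Qed.

Lemma star_inj : injective (fun i => [set child i; base center i]).
Proof.
have be_al i j : be i != al j by rewrite eq_sym.
case=> [[u uc]|i] [[v vc]|j] /setP /= eq_ij.
- congr inl; apply: val_inj => /=; have := eq_ij u.
  by rewrite !inE eqxx (negPf uc) !orbF => /esym/eqP.
- by have := eq_ij c; rewrite !inE eqxx orbT !(eq_sym c) (negPf (al_neq _)) (negPf (be_neq _)).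
- by have := eq_ij c; rewrite !inE eqxx orbT !(eq_sym c) (negPf (al_neq _)) (negPf (be_neq _)).
- congr inr; have := eq_ij (al i).
  by rewrite !inE eqxx !(negPf (al_be _ _)) !orbF => /esym/eqP/al_inj.
Qed.

Variable m : nat.
Hypothesis m_ge2 : (2 <= m)%N.

Let o3 k (h : k < 3) : 'I_3 := Ordinal h.
Let a0 := al (@o3 0 isT). Let a1 := al (@o3 1 isT). Let a2 := al (@o3 2 isT).
Let b0 := be (@o3 0 isT). Let b1 := be (@o3 1 isT). Let b2 := be (@o3 2 isT).

(** The order is that of v_1, ..., v_7: the centre, then the ends of each chord, which is the edge
    opposite v_1 in its triangle. *)
Let hub : seq V := [:: c; a0; b0; a1; b1; a2; b2].

Let o3P (j : 'I_3) : [\/ j = @o3 0 isT, j = @o3 1 isT | j = @o3 2 isT].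
Proof.
case: j => [[|[|[|//]]] h]; [apply: Or31|apply: Or32|apply: Or33]; exact: val_inj.
Qed.

Lemma hub_uniq : uniq hub.
Proof.
have be_al i j : be i != al j by rewrite eq_sym.
rewrite /= !inE !negb_or !(eq_sym c) !al_neq !be_neq !al_be !be_al.
by rewrite !(inj_eq al_inj) !(inj_eq be_inj).
Qed.

Let Z : seq V := enum [predC hub].
(** The index of the tree edge at [v]; the default in [insubd] makes it total, while its uses
    concern vertices other than [c]. *)
Let te (v : V) : tree_index := inl (insubd (Sub a0 (al_neq _)) v).

Let teE v : v != c -> child (te v) = v.
Proof. by move=> vc; rewrite /= insubdK. Qed.

Let te_val (v : {v : V | v != c}) : te (val v) = inl v.
Proof. by rewrite /te valKd. Qed.

Let te_inj u v : u != c -> v != c -> te u = te v -> u = v.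
Proof. by move=> uc vc uv; rewrite -(teE uc) uv teE. Qed.

Lemma size_outside_hub : size Z = #|V| - 7.
Proof.
rewrite -cardE; have := cardC [in hub].
by rewrite (card_uniqP hub_uniq) => <-; rewrite addKn; apply: eq_card.
Qed.

Let l := only_c1 (#|V| - 7).
(** Listed in the order of [T2C_ends]: in each triangle a tree edge, the chord, and the other tree
    edge. *)
Let edge_index : seq tree_index :=
  [:: te a0; inr (@o3 0 isT); te b0; te a1; inr (@o3 1 isT); te b1;
      te a2; inr (@o3 2 isT); te b2].

(** A pendant edge has m - 1 new vertices, but its counterpart has a leaf from [Z] and m - 2 added
    vertices. The last new vertex, where [insub] fails, is sent to the leaf. *)
Let f (v : T2C_vert m l) : thick_vert V tree_index (m - 2) :=
  match v with
  | inl i => inl (nth c hub i)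
  | inr (inl (j, t)) => inr (nth (te a0) edge_index j, t)
  | inr (inr x) => if insub (val (tagged x).2) is Some t
                   then inr (te (nth c Z (tagged x).1), t)
                   else inl (nth c Z (tagged x).1)
  end.

Let pendant_tag (i : 'I_7) (p : 'I_(l i)) : i = ord0 /\ p < size Z.
Proof.
move: p; rewrite size_outside_hub /l /only_c1.
by case: eqP => [->|_] p; case: p.
Qed.

Let nthZ p : p < size Z -> nth c Z p \notin hub.
Proof. by move=> p_lt; have := mem_nth c p_lt; rewrite mem_enum. Qed.

Let nthZ_neq p : p < size Z -> nth c Z p != c.
Proof. by move/nthZ; apply: contraNneq => ->; rewrite mem_head. Qed.

Let edge_index_uniq : uniq edge_index.
Proof.
have te_eq u v : u != c -> v != c -> (te u == te v) = (u == v).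
  by move=> uc vc; apply/eqP/eqP => [/te_inj->//|->].
have := hub_uniq; rewrite /= !inE !negb_or !te_eq ?al_neq ?be_neq //.
by case/and5P=> _ /and5P[-> -> -> -> ->] /and4P[-> -> -> ->] /and3P[-> -> ->] /andP[-> ->].
Qed.

Let child_edge_index j : j < 9 -> child (nth (te a0) edge_index j) \in hub.
Proof.
by do 9?[case: j => [_|j] /=; first by rewrite ?insubdK ?inE ?eqxx ?orbT //
  -?topredE /= ?al_neq ?be_neq].
Qed.

Let f_inj : injective f.
Proof.
have hub_pendant (i : 'I_7) p : p < size Z -> nth c hub i != nth c Z p.
  move=> /nthZ; apply: contraNneq => <-; exact: mem_nth.
have hub_edge (j : 'I_9) p : p < size Z -> nth (te a0) edge_index j != te (nth c Z p).
  move=> p_lt; apply: contraNneq (nthZ p_lt) => /(congr1 child).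
  by rewrite teE ?nthZ_neq // => <-; apply: child_edge_index.
case=> [i|[[j t]|[i [p t]]]] [i'|[[j' t']|[i' [p' t']]]] //=.
- by case=> /eqP; rewrite nth_uniq ?hub_uniq // => /eqP/val_inj->.
- have [_ p_lt] := pendant_tag p'; case: insubP => //= _ [] /eqP.
  by rewrite (negPf (hub_pendant _ _ p_lt)).
- by case=> /eqP; rewrite nth_uniq // => /eqP/val_inj-> ->.
- have [_ p_lt] := pendant_tag p'; case: insubP => //= u _ _ [] /eqP.
  by rewrite (negPf (hub_edge _ _ p_lt)).
- have [_ p_lt] := pendant_tag p; case: insubP => //= _ [] /eqP.
  by rewrite eq_sym (negPf (hub_pendant _ _ p_lt)).
- have [_ p_lt] := pendant_tag p; case: insubP => //= u _ _ [] /eqP.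
  by rewrite eq_sym (negPf (hub_edge _ _ p_lt)).
have [i0 p_lt] := pendant_tag p; have [i0' p_lt'] := pendant_tag p'.
subst i i'.
have same : nth c Z p = nth c Z p' -> p = p'.
  by move/eqP; rewrite nth_uniq ?enum_uniq // => /eqP/val_inj.
case: insubP => [u _ ut|t_ge]; case: insubP => [u' _ ut'|t_ge'] //.
  move=> e; have /eqP := inr_inj e; rewrite xpair_eqE => /andP[/eqP/te_inj zz /eqP uu].
  have -> := same (zz (nthZ_neq p_lt) (nthZ_neq p_lt')).
  by have -> : t = t' 
    by apply: val_inj; apply: etrans (esym ut) (etrans (congr1 val uu) ut').
move=> e; rewrite (same (inl_inj e)); have -> // : t = t'.
apply: val_inj; move: t_ge t_ge' => /=; rewrite -!leqNgt.
by move: (ltn_ord t) (ltn_ord t'); lia.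
Qed.

Let f_bij : bijective f.
Proof.
apply: (inj_card_bij f_inj).
(* The seven hub vertices make the truncated subtraction in [l] exact. *)
have := max_card [in hub]; rewrite (card_uniqP hub_uniq) /= => V_ge.
rewrite !card_sum !card_prod card_sum !card_ord.
rewrite card_sig /=.
rewrite (cardC1 c).
rewrite card_tagged sumnE big_map big_enum /= (bigD1 ord0) //= big1 => [|i i0].
  rewrite card_prod !card_ord /l /only_c1 eqxx.
  have -> : m - 1 = (m - 2).+1 by lia.
  have [v ->] : exists v, #|V| = v + 7 by exists (#|V| - 7); rewrite subnK.
  by move: (m - 2) => q; rewrite addnK; nia.
by rewrite card_prod card_ord /l /only_c1 (negPf i0).
Qed.

Let cycle_edge_image j :
  f @: T2C_cycle_edge m l j
  = thick_edge child (base center) (m - 2) (nth (te a0) edge_index j).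
Proof.
rewrite /T2C_cycle_edge imsetU imsetU1 imset_set1 -imset_comp.
congr (_ :|: _).
have insE (u : {v | v != c}) v : v != c -> sval (insubd u v) = v.
  by move=> vc; apply: (insubdK u).
by case: j => j; do 9?[case: j => [|j]] => // h; rewrite /= !inordK //=
  ?insE ?al_neq ?be_neq // setUC.
Qed.

Let pendant_image (ip : {i : 'I_7 & 'I_(l i)}) :
  f @: T2C_pendant_edge m ip
  = thick_edge child (base center) (m - 2) (te (nth c Z (tagged ip))).
Proof.
case: ip => i p /=; have [i0 p_lt] := pendant_tag p.
rewrite /T2C_pendant_edge imsetU1 -imset_comp.
have -> : f (inl i) = inl c by rewrite /= i0.
have zc := nthZ_neq p_lt; set z := nth c Z p.
apply/setP => -[v|[e t]]; rewrite ?inl_thick_edge ?inr_thick_edge.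
  rewrite -[child _]/(child (te z)) teE // /center in_setU1.
  rewrite (inj_eq (@inl_inj _ _)) orbC; congr (_ || _).
  apply/imsetP/eqP => [[t _ /=]|->].
    by case: insubP => //= _ [].
  have m_lt : m - 2 < m - 1 by lia.
  by exists (Ordinal m_lt) => //=; rewrite insubN ?ltnn.
rewrite in_setU1 /=; apply/imsetP/eqP => [[s _ /=]|->].
  by case: insubP => //= u _ _ [].
have t_lt : t < m - 1 by move: (ltn_ord t); lia.
by exists (Ordinal t_lt) => //=; rewrite valK.
Qed.

Lemma T2C_star :
  isomorphic (T2C m l) (thick child (base center) (m - 2)).
Proof.
exists f => //; apply/setP => X; apply/imsetP/imsetP => [[Y + ->]|[i _ ->]].
  rewrite inE => /orP[] /imsetP[j _ ->].
    by rewrite cycle_edge_image; eexists.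
  by rewrite pendant_image; eexists.
have cycle_edge (j : 'I_9) : nth (te a0) edge_index j = i -> exists2 Y,
    Y \in edges (T2C m l) & thick_edge child (base center) (m - 2) i = f @: Y.
  move=> ji; exists (T2C_cycle_edge m l j); last by rewrite cycle_edge_image ji.
  by rewrite inE imset_f.
case: i cycle_edge => [v|j] cycle_edge; last first.
  (* The chords occupy the middle positions 1, 4 and 7 of [edge_index]. *)
  case: (o3P j) cycle_edge => -> cycle_edge.
  - exact: (cycle_edge (@Ordinal 9 1 isT)).
  - exact: (cycle_edge (@Ordinal 9 4 isT)).
  - exact: (cycle_edge (@Ordinal 9 7 isT)).
have [v_hub|v_hub] := boolP (val v \in hub).
  have vE u : val v == u -> te u = inl v by move/eqP <-; apply: te_val.
  move: v_hub; rewrite !inE (negPf (valP v)) /=.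
  case/or4P => [/vE v_eq|/vE v_eq|/vE v_eq|/or3P[/vE v_eq|/vE v_eq|/vE v_eq]].
  - exact: (cycle_edge (@Ordinal 9 0 isT)).
  - exact: (cycle_edge (@Ordinal 9 2 isT)).
  - exact: (cycle_edge (@Ordinal 9 3 isT)).
  - exact: (cycle_edge (@Ordinal 9 5 isT)).
  - exact: (cycle_edge (@Ordinal 9 6 isT)).
  - exact: (cycle_edge (@Ordinal 9 8 isT)).
have v_Z : val v \in Z by rewrite mem_enum.
have p_lt : index (val v) Z < l ord0.
  by rewrite /l /only_c1 eqxx -size_outside_hub index_mem.
pose ip : {i : 'I_7 & 'I_(l i)} := Tagged (fun i => 'I_(l i)) (Ordinal p_lt).
exists (T2C_pendant_edge m ip); first by rewrite inE orbC imset_f.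
by rewrite pendant_image /= nth_index // te_val.
Qed.

End Star.

(** * The quotient system of the star and its polynomial *)

(** Here m = q + 2 and k = n + 9. The factors [N], [D] and [E] are the coefficients met when the
    quotient system is solved for its unknowns, and the right side is its equation at the centre
    multiplied by [N * D * E]. *)
Lemma horner_gamma_poly (C : numClosedFieldType) (n q : nat) (z : C) :
  let N := z ^+ 2 - q%:R * z - 2 * q%:R - 1 in
  let D := z - q%:R + 1 in
  let E := z - q%:R in
  (gamma_poly C q.+2 (n + 9)).[z] =
  z * N * D * E - 6 * (z + 1) * D * E - 6 * q%:R * E * (N + z + 1)
  - n%:R * (q%:R + 1) * N * D.
Proof.
have natP k : k%:R = (k%:R)%:P :> {poly C} by rewrite polyC_natr.
rewrite /gamma_poly !natP !(hornerD, hornerN, hornerM, hornerXn, hornerX, hornerC).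
have -> : q.+2%:R = q%:R + 2 :> C by rewrite -natrD addn2.
have -> : (n + 9)%:R = n%:R + 9 :> C by rewrite natrD.
by ring.
Qed.

Section QuotientEquations.
Variables (C : numClosedFieldType) (n q : nat) (r c Y W S P : C).
Hypotheses (c_eq : r * c = Y + W + P)
  (Y_eq : r * Y = 6 * c + W + Y + 2 * S)
  (W_eq : r * W = q%:R * (6 * c + Y + W) - W)
  (S_eq : r * S = q%:R * (Y + S) - S)
  (P_eq : r * P = n%:R * (q%:R + 1) * c + q%:R * P).

(** The last four equations express [D * W] and [D * S] through c and Y, and [N * Y] and [E * P]
    through c alone. Substituted into N D E times the first equation, they leave the value of the
    polynomial times c. *)
Lemma quotient_root : c != 0 -> root (gamma_poly C q.+2 (n + 9)) r.
Proof.
move=> c_neq0; rewrite /root horner_gamma_poly.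
rewrite -(mulIr_eq0 _ (mulIf c_neq0)).
set N := _ - _ - 1; set D := r - q%:R + 1; set E := r - q%:R.
have DW : D * W = q%:R * (6 * c + Y).
  rewrite /D mulrDl mulrBl W_eq; ring.
have DS : D * S = q%:R * Y by rewrite /D mulrDl mulrBl S_eq; ring.
have EP : E * P = n%:R * (q%:R + 1) * c by rewrite /E mulrBl P_eq; ring.
have NY : N * Y = 6 * (r + 1) * c.
  have : D * (r * Y) = D * (6 * c + Y) + D * W + 2 * (D * S).
    by rewrite Y_eq; ring.
  rewrite DW DS => /eqP; rewrite -subr_eq0 => /eqP e.
  apply/eqP; rewrite -subr_eq0 -e; apply/eqP; rewrite /N /D; ring.
apply/eqP; transitivity (N * D * E * (r * c - (Y + W + P))); last first.
  by rewrite c_eq subrr mulr0.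
have -> : N * D * E * (r * c - (Y + W + P)) = r * N * D * E * c
   - D * E * (N * Y) - N * E * (D * W) - N * D * (E * P) by ring.
rewrite DW EP NY.
have -> : N * E * (q%:R * (6 * c + Y)) = 6 * q%:R * N * E * c
   + q%:R * E * (N * Y) by ring.
rewrite NY; ring.
Qed.

Hypotheses (r_gt : q%:R < r) (c_gt0 : 0 < c) (Y_ge0 : 0 <= Y) (W_ge0 : 0 <= W)
  (S_ge0 : 0 <= S) (P_ge0 : 0 <= P).

(** The bound is the larger root of X^2 - (m + 4) X - (k - 3)(m - 1), so the strict inequality
    [quad] suffices. Multiplying the first equation by r leaves the excess Y + 2 S, which is below 6
    r c because Y < 6 c. *)
Lemma quotient_bound :
  r < (q.+2%:R + 4 + sqrtC ((q.+2%:R + 4) ^+ 2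
         + 4 * ((n + 9)%:R - 3) * (q.+2%:R - 1))) / 2.
Proof.
have r_gt0 : 0 < r by apply: le_lt_trans r_gt; apply: ler0n.
have D_gt0 : 0 < r - q%:R + 1 by rewrite ltr_wpDr // subr_gt0.
have [Y_real c_real] := (ger0_real Y_ge0, gtr0_real c_gt0).
have W5S2 : 0 <= 5 * W - 2 * S.
  rewrite -(pmulr_rge0 _ D_gt0).
  have -> : (r - q%:R + 1) * (5 * W - 2 * S)
      = 5 * (r * W - q%:R * W + W) - 2 * (r * S - q%:R * S + S) by ring.
  rewrite W_eq S_eq.
  have -> : 5 * (q%:R * (6 * c + Y + W) - W - q%:R * W + W)
      - 2 * (q%:R * (Y + S) - S - q%:R * S + S) = q%:R * (30 * c + 3 * Y).
    by ring.
  by rewrite mulr_ge0 ?addr_ge0 ?mulr_ge0 // ltW.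
(* Otherwise r (6 c - Y) would be nonpositive, although it expands into nonnegative terms including
   4 Y > 0. *)
have Y_lt : Y < 6 * c.
  rewrite real_ltNge ?realM //; apply/negP => Y_ge.
  have : r * (6 * c - Y) <= 0 by rewrite pmulr_rle0 // subr_le0.
  have -> : r * (6 * c - Y) = 4 * Y + (5 * W - 2 * S) + 6 * P + (Y - 6 * c).
    rewrite mulrBr Y_eq [_ * (6 * c)]mulrCA c_eq; ring.
  apply/negP; rewrite -real_ltNge ?real0 ?ger0_real //; last first.
    by rewrite addr_ge0 ?subr_ge0 // addr_ge0 ?mulr_ge0 // addr_ge0 ?mulr_ge0.
  rewrite ltr_wpDr ?subr_ge0 // ltr_wpDr ?mulr_ge0 // ltr_wpDr //.
  by rewrite mulr_gt0 // (lt_le_trans _ Y_ge) ?mulr_gt0.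
have YS : Y + 2 * S < 6 * r * c.
  rewrite -subr_gt0.
  have -> : 6 * r * c - (Y + 2 * S) = 6 * c + W + r * (6 * c - Y).
    rewrite mulrBr Y_eq; ring.
  have cW : 0 < 6 * c + W by rewrite ltr_wpDr ?mulr_gt0.
  by rewrite addr_gt0 ?mulr_gt0 ?subr_gt0.
have quad : r ^+ 2 < (q%:R + 6) * r + (n%:R + 6) * (q%:R + 1).
  rewrite -(ltr_pM2r c_gt0).
  have -> : r ^+ 2 * c = r * Y + r * W + r * P.
    by rewrite expr2 -mulrA c_eq; ring.
  have -> : r * Y + r * W + r * P = ((n%:R + 6) * (q%:R + 1) + q%:R * r) * c + (Y + 2 * S).
    transitivity ((n%:R + 6) * (q%:R + 1) * c + q%:R * (Y + W + P)
                  + (Y + 2 * S)); first by rewrite Y_eq W_eq P_eq; ring.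
    by rewrite -c_eq; ring.
  rewrite -subr_gt0.
  have -> : ((q%:R + 6) * r + (n%:R + 6) * (q%:R + 1)) * c -
    (((n%:R + 6) * (q%:R + 1) + q%:R * r) * c + (Y + 2 * S))
    = 6 * r * c - (Y + 2 * S) by ring.
  by rewrite subr_gt0.
have -> : q.+2%:R = q%:R + 2 :> C by rewrite -natrD addn2.
have -> : (n + 9)%:R = n%:R + 9 :> C by rewrite natrD.
set d := (X in sqrtC X).
(* The discriminant exceeds the square of [u] by four times the gap in [quad], so its root exceeds
   [u]. *)
have dE : d = (2 * r - (q%:R + 6)) ^+ 2
    + 4 * ((q%:R + 6) * r + (n%:R + 6) * (q%:R + 1) - r ^+ 2).
  by rewrite /d; ring.
rewrite ltr_pdivlMr //; set u := 2 * r - (q%:R + 6) in dE.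
have u_real : u \is Num.real.
  by rewrite /u realB ?realM ?realD ?realn ?(gtr0_real r_gt0).
have du : u ^+ 2 < d by rewrite dE ltrDl mulr_gt0 ?subr_gt0.
have d_ge0 : 0 <= d by rewrite ltW // (le_lt_trans _ du) // real_exprn_even_ge0.
rewrite -subr_gt0.
have -> : q%:R + 2 + 4 + sqrtC d - r * 2 = sqrtC d - u by rewrite /u; ring.
rewrite subr_gt0 (le_lt_trans (real_ler_norm u_real)) //.
rewrite -ltr_sqr ?nnegrE ?sqrtC_ge0 ?normr_ge0 // real_normK //.
by rewrite sqrtCK.
Qed.

End QuotientEquations.

(** * Eigenvectors and spectral radius of the star with three chords *)

Section StarSpectrum.
Variables (V : finType) (c : V) (al be : 'I_3 -> V).
Hypotheses (al_neq : forall j, al j != c) (be_neq : forall j, be j != c).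
Hypotheses (al_inj : injective al) (be_inj : injective be).
Hypothesis al_be : forall i j, al i != be j.

Local Notation leaf := {v : V | v != c}.
Let al' j : leaf := Sub (al j) (al_neq j).
Let be' j : leaf := Sub (be j) (be_neq j).
Let outer (u : leaf) := [forall j, (val u != al j) && (val u != be j)].

Lemma sum_leaves (R : nmodType) (F : leaf -> R) :
  \sum_u F u = \sum_j F (al' j) + \sum_j F (be' j) + \sum_(u | outer u) F u.
Proof.
pose A := [set al' j | j : 'I_3]; pose B := [set be' j | j : 'I_3].
have al'_inj : injective al' by move=> i j /(congr1 val) /= /al_inj.
have be'_inj : injective be' by move=> i j /(congr1 val) /= /be_inj.
have AP u : (u \in A) = [exists j, val u == al j].
  apply/imsetP/existsP => [[j _ ->]|[j /eqP uj]]; exists j => //.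
  exact: val_inj.
have BP u : (u \in B) = [exists j, val u == be j].
  apply/imsetP/existsP => [[j _ ->]|[j /eqP uj]]; exists j => //.
  exact: val_inj.
rewrite (bigID (mem A)) (bigID (mem B) (fun u => u \notin A)) /= addrA.
congr (_ + _ + _).
- by rewrite big_imset //=; apply: in2W.
- rewrite -(big_imset _ (in2W be'_inj)) /=; apply: eq_bigl => u.
  rewrite andb_idl // BP AP => /existsP[j /eqP->]; apply/existsP => -[i].
  by rewrite eq_sym (negPf (al_be _ _)).
apply: eq_bigl => u; rewrite AP BP !negb_exists.
apply/andP/forallP => [[/forallP h1 /forallP h2] j|h]; first by rewrite h1 h2.
by split; apply/forallP => j; case/andP: (h j).
Qed.

Lemma card_outer : (#|[pred u | outer u]| + 7)%N = #|V|.
Proof.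
have : #|{: leaf}| = #|V|.-1 by rewrite card_sig (cardC1 c).
(* The leaves are counted by summing the constant 1 over the three classes. *)
have := sum_leaves (fun=> 1 : int); rewrite !sumr_const card_ord -!natrD.
move=> /eqP; rewrite eqr_nat => /eqP; rewrite -[#|outer|]/#|[pred u | outer u]|.
have : (0 < #|V|)%N by apply/card_gt0P; exists c.
move=> V_gt0 e; rewrite (_ : #|{: leaf}| = (3 + 3 + #|[pred u | outer u]|)%N).
  lia.
by rewrite -e; apply: eq_card.
Qed.

Variable q : nat.
Let star := thick (child (c := c) al) (base be (fun=> c)) q.

Section NeighbourSums.
Variables (C : numClosedFieldType) (x : vert star -> C).

Let w i := \sum_t x (inr (i, t)).

Lemma star_center :
  nbr_sum x (inl c) = \sum_(u : leaf) (x (inl (val u)) + w (inl u)).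
Proof.
rewrite (nbr_sum_thick_inl (star_neq al_be) (star_inj _ _ _ al_be)) //.
rewrite big_mkcond big_sumType /= [X in _ + X]big1 ?addr0.
  apply: eq_bigr => u _; rewrite eqxx orbT /w; ring.
by move=> j _; rewrite !(eq_sym c) (negPf (al_neq j)) (negPf (be_neq j)).
Qed.

Lemma star_leaf (u : leaf) :
  nbr_sum x (inl (val u)) = x (inl c) + w (inl u)
  + \sum_j ((if val u == al j then x (inl (be j)) + w (inr j) else 0)
            + (if val u == be j then x (inl (al j)) + w (inr j) else 0)).
Proof.
rewrite (nbr_sum_thick_inl (star_neq al_be) (star_inj _ _ _ al_be)) //.
rewrite big_mkcond big_sumType /=; congr (_ + _).
  rewrite (bigD1 u) //= eqxx [X in _ + X]big1 ?addr0 /w /=; first by ring.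
  move=> u' u'u; rewrite (inj_eq val_inj) eq_sym (negPf u'u).
  by rewrite (negPf (valP u)).
apply: eq_bigr => j _; rewrite /w.
have [->|_] := eqVneq (val u) (al j).
  by rewrite (negPf (al_be j j)); ring.
by have [->|_] /= := eqVneq (val u) (be j); ring.
Qed.

Lemma star_al j : nbr_sum x (inl (al j)) =
  x (inl c) + w (inl (al' j)) + (x (inl (be j)) + w (inr j)).
Proof.
rewrite (star_leaf (al' j)) (bigD1 j) //= eqxx (negPf (al_be _ _)) addr0.
rewrite big1 ?addr0 // => i ij.
by rewrite (inj_eq al_inj) (eq_sym j) (negPf ij) (negPf (al_be _ _)) addr0.
Qed.

Lemma star_be j : nbr_sum x (inl (be j)) =
  x (inl c) + w (inl (be' j)) + (x (inl (al j)) + w (inr j)).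
Proof.
have be_al i k : (be i == al k) = false by rewrite eq_sym; apply: negPf (al_be _ _).
rewrite (star_leaf (be' j)) (bigD1 j) //= eqxx be_al add0r.
rewrite big1 ?addr0 // => i ij.
by rewrite (inj_eq be_inj) (eq_sym j) (negPf ij) be_al addr0.
Qed.

Lemma star_outer (u : leaf) : outer u ->
  nbr_sum x (inl (val u)) = x (inl c) + w (inl u).
Proof.
move=> /forallP u_out; rewrite star_leaf big1 ?addr0 // => j _.
by have /andP[/negPf-> /negPf->] := u_out j; rewrite addr0.
Qed.

Lemma star_inr i t : nbr_sum x (inr (i, t)) =
  x (inl (child al i)) + x (inl (base be (fun=> c) i)) + w i - x (inr (i, t)).
Proof.
exact: (nbr_sum_thick_inr (star_neq al_be) (star_inj _ _ _ al_be)).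
Qed.

Lemma star_edge_sum z : (forall v, nbr_sum x v = z * x v) -> forall i,
  z * w i =
  q%:R * (x (inl (child al i)) + x (inl (base be (fun=> c) i)) + w i) - w i.
Proof.
move=> xz i; rewrite {1}/w mulr_sumr.
under eq_bigr => t _ do rewrite -xz star_inr.
by rewrite sumrB sumr_const card_ord mulr_natl.
Qed.

(** Class totals close up into a linear system without any claim that the eigenvector is constant on
    equivalent vertices. Y covers the chord ends, W the added vertices of their tree edges, S those
    of the chords, and P the remaining leaves with the added vertices of their edges. *)
Definition quotient_Y := \sum_j (x (inl (al j)) + x (inl (be j))).
Definition quotient_W := \sum_j (w (inl (al' j)) + w (inl (be' j))).
Definition quotient_S := \sum_j w (inr j).
Definition quotient_P := \sum_(u : leaf | outer u) (x (inl (val u)) + w (inl u)).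

Lemma star_quotient z : (forall v, nbr_sum x v = z * x v) ->
  let c0 := x (inl c) in
  let Y := quotient_Y in let W := quotient_W in
  let S := quotient_S in let P := quotient_P in
  [/\ z * c0 = Y + W + P,
     z * Y = 6 * c0 + W + Y + 2 * S,
     z * W = q%:R * (6 * c0 + Y + W) - W,
     z * S = q%:R * (Y + S) - S
   & z * P = (#|V| - 7)%:R * (q%:R + 1) * c0 + q%:R * P].
Proof.
move=> xz /=; have w_eq := star_edge_sum xz.
have sum3 (a : C) : \sum_(j < 3) a = 3 * a.
  by rewrite sumr_const card_ord mulr_natl.
split.
- rewrite -xz star_center sum_leaves /quotient_Y /quotient_W; congr (_ + _).
  by rewrite -!big_split /=; apply: eq_bigr => j _; ring.
- rewrite mulr_sumr.
  under eq_bigr => j _ do rewrite mulrDr -!xz star_al star_be.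
  (* The factor 6 is split so that [sum3] can absorb 3 into a sum over the chords, to be compared
     termwise. *)
  transitivity (2 * (3 * x (inl c)) + quotient_W + quotient_Y + 2 * quotient_S); last by ring.
  rewrite -sum3 /quotient_Y /quotient_W /quotient_S !mulr_sumr -!big_split /=.
  by apply: eq_bigr => j _; ring.
- rewrite mulr_sumr; under eq_bigr => j _ do rewrite mulrDr !w_eq /=.
  transitivity (q%:R * (2 * (3 * x (inl c)) + quotient_Y + quotient_W)
                - quotient_W); last by ring.
  rewrite -sum3 /quotient_Y /quotient_W !mulr_sumr -!big_split mulr_sumr -sumrB.
  by apply: eq_bigr => j _ /=; ring.
- rewrite mulr_sumr; under eq_bigr => j _ do rewrite w_eq /=.
  rewrite /quotient_Y /quotient_S -!big_split mulr_sumr -sumrB /=.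
  by apply: eq_bigr => j _; ring.
rewrite mulr_sumr (eq_bigr (fun u => (q%:R + 1) * x (inl c)
  + q%:R * (x (inl (val u)) + w (inl u)))) => [|u u_out].
  rewrite big_split /= sumr_const -mulr_sumr; congr (_ + _).
  by rewrite -card_outer addnK -[RHS]mulrA [RHS]mulr_natl.
rewrite mulrDr -xz star_outer // w_eq /=; ring.
Qed.

End NeighbourSums.

Lemma star_connected : hconnected star.
Proof.
have adj_edge (u v : vert star) i : u != v ->
    u \in thick_edge (child al) (base be (fun=> c)) q i ->
    v \in thick_edge (child al) (base be (fun=> c)) q i -> connect (@adjacent star) u v.
  move=> uv ui vi; apply: connect1; rewrite /adjacent uv; apply/exists_inP.
  by exists (thick_edge (child al) (base be (fun=> c)) q i); rewrite ?imset_f // ui.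
have center_leaf (u : leaf) : connect (@adjacent star) (inl c) (inl (val u)).
  apply: (@adj_edge _ _ (inl u)); rewrite ?inl_thick_edge /= ?eqxx ?orbT //.
  by rewrite (inj_eq (@inl_inj _ _)) eq_sym (valP u).
have center v : connect (@adjacent star) (inl c) v.
  case: v => [v|[[u|j] t]].
  - by have [->//|vc] := eqVneq v c; apply: (center_leaf (Sub v vc)).
  - by apply: (@adj_edge _ _ (inl u)); rewrite ?inl_thick_edge ?inr_thick_edge /= ?eqxx ?orbT.
  apply: connect_trans (center_leaf (al' j)) _.
  by apply: (@adj_edge _ _ (inr j)); rewrite ?inl_thick_edge ?inr_thick_edge /= ?eqxx.
move=> u v; apply: connect_trans (center v).
by rewrite (sym_connect_sym (@adjacent_sym star)).
Qed.

Section QuotientVector.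
Variables (C : numClosedFieldType) (z : C).
Let N := z ^+ 2 - q%:R * z - 2 * q%:R - 1.
Let D := z - q%:R + 1.
Let E := z - q%:R.

(* The solution of the quotient system of [star_quotient] other than its
   equation at c, scaled by N D E so as to be polynomial in z. *)
Definition quotient_vector (v : vert star) : C :=
  match v with
  | inl v => if v == c then N * D * E else
             if [forall j, (v != al j) && (v != be j)] then N * D
             else (z + 1) * D * E
  | inr (inl u, _) => if outer u then N * D else E * (N + z + 1)
  | inr (inr _, _) => 2 * (z + 1) * E
  end.

Let al_outer j : [forall i, (al j != al i) && (al j != be i)] = false.
Proof. by apply/negbTE/forallPn; exists j; rewrite eqxx. Qed.

Let be_outer j : [forall i, (be j != al i) && (be j != be i)] = false.
Proof. by apply/negbTE/forallPn; exists j; rewrite eqxx andbF. Qed.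

Let al'_outer j : outer (al' j) = false.
Proof. exact: al_outer. Qed.

Let be'_outer j : outer (be' j) = false.
Proof. exact: be_outer. Qed.

Lemma quotient_vector_al j : quotient_vector (inl (al j)) = (z + 1) * D * E.
Proof. by rewrite /= (negPf (al_neq _)) al_outer. Qed.

Lemma quotient_vector_be j : quotient_vector (inl (be j)) = (z + 1) * D * E.
Proof. by rewrite /= (negPf (be_neq _)) be_outer. Qed.

(** At [c] the eigenvalue equation is, up to sign, the vanishing of the polynomial at [z]; at all
    other vertices it is an identity in [z]. *)
Lemma quotient_vector_eigen : root (gamma_poly C q.+2 (#|V| - 7 + 9)) z ->
  forall v, nbr_sum quotient_vector v = z * quotient_vector v.
Proof.
rewrite /root horner_gamma_poly -/N -/D -/E => /eqP z_root.
have leafE (u : leaf) : quotient_vector (inl (val u)) =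
    if outer u then N * D else (z + 1) * D * E.
  by rewrite /= (negPf (valP u)).
have const (a : C) : \sum_(t < q) a = q%:R * a.
  by rewrite sumr_const card_ord mulr_natl.
have centerE : quotient_vector (inl c) = N * D * E by rewrite /= eqxx.
case=> [v|[i t]].
  have [->|vc] := eqVneq v c.
    rewrite star_center sum_leaves.
    have out_sum : \sum_(u : leaf | outer u) (quotient_vector (inl (val u))
        + \sum_(t < q) quotient_vector (inr (inl u, t)))
        = (#|V| - 7)%:R * (N * D + q%:R * (N * D)).
      rewrite (eq_bigr (fun=> N * D + q%:R * (N * D))) => [|u u_out].
        by rewrite sumr_const -card_outer addnK [RHS]mulr_natl.
      by rewrite leafE /= u_out const.
    rewrite out_sum centerE; apply/eqP; rewrite -subr_eq0 -oppr_eq0.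
    apply/eqP; rewrite -[RHS]z_root.
    under eq_bigr => j _ do rewrite quotient_vector_al /= al'_outer const.
    under [X in _ + X + _]eq_bigr => j _ do rewrite quotient_vector_be /= be'_outer const.
    by rewrite !sumr_const !card_ord /N /D /E; ring.
  have [v_out|] := boolP (outer (Sub v vc)).
    rewrite -[v]/(val (Sub v vc : leaf)) star_outer // centerE leafE v_out /= v_out.
    by rewrite const /N /D /E; ring.
  case/forallPn => j; rewrite negb_and !negbK => /orP[] /eqP vE.
    rewrite (_ : v = al j) //.
    rewrite star_al centerE quotient_vector_al quotient_vector_be /= al'_outer !const.
    by rewrite /N /D /E; ring.
  rewrite (_ : v = be j) //.
  rewrite star_be centerE quotient_vector_al quotient_vector_be /= be'_outer !const.
  by rewrite /N /D /E; ring.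
rewrite star_inr; case: i => [u|j].
  rewrite -[child al (inl u)]/(val u) -[base be _ _]/c centerE leafE /= const.
  by case: ifP => _; rewrite /N /D /E; ring.
rewrite -[child al (inr j)]/(al j) -[base be _ _]/(be j).
rewrite quotient_vector_al quotient_vector_be /= const.
by rewrite /N /D /E; ring.
Qed.

End QuotientVector.

Section Radius.
Variable C : numClosedFieldType.
Let r : C := (q.+2%:R - 1) * lambda1 C q.+2 star.

Lemma star_perron : exists2 x : vert star -> C,
  forall v, 0 < x v & forall v, nbr_sum x v = r * x v.
Proof.
have [x [x_ge0 x_neq0 xr]] := perron_vector C (isT : (2 <= q.+2)%N) (inl c : vert star).
exists x => //; exact: (perron_vector_gt0 star_connected x_ge0 x_neq0 xr).
Qed.

(** These bounds keep [z + 1], [z - q] and [z - q + 1] nonzero when the modulus of [z] is at least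
    r. They come from adding the equations of a chord end and of the added vertices on its tree
    edge, and those of both ends of a chord. *)
Lemma star_radius_gt : q%:R < r /\ 1 < r.
Proof.
have [x x_gt0 xr] := star_perron.
have w_ge0 i : 0 <= \sum_t x (inr (i, t)) by apply: sumr_ge0 => t _; apply: ltW.
pose j : 'I_3 := ord0; have := star_al x j; have := star_be x j; rewrite !xr.
set a := x (inl (al j)); set b := x (inl (be j)); set c0 := x (inl c).
have [a_gt0 b_gt0 c_gt0] : [/\ 0 < a, 0 < b & 0 < c0] by split; apply: x_gt0.
set wb := \sum_t _; set wj := \sum_t x (inr (inr j, t)).
have wb_ge0 : 0 <= wb := w_ge0 _; have wj_ge0 : 0 <= wj := w_ge0 _.
set wa := \sum_t x (inr (inl (al' j), t)); have wa_ge0 : 0 <= wa := w_ge0 _.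
move=> b_eq a_eq; split.
  have aw_gt0 : 0 < a + wa by rewrite ltr_wpDr.
  rewrite -(ltr_pM2r aw_gt0) -subr_gt0.
  have := star_edge_sum xr (inl (al' j)); rewrite /= -/a -/c0 -/wa => wa_eq.
  have -> : r * (a + wa) - q%:R * (a + wa) = c0 + b + wj + q%:R * c0.
    rewrite [r * _]mulrDr a_eq wa_eq; ring.
  by rewrite ltr_wpDr ?mulr_ge0 ?(ltW c_gt0) // ltr_wpDr // addr_gt0.
have ab_gt0 : 0 < a + b by rewrite addr_gt0.
rewrite -(ltr_pM2r ab_gt0) -subr_gt0.
have -> : r * (a + b) - 1 * (a + b) = c0 + c0 + (wa + wb + wj + wj).
  rewrite [r * _]mulrDr a_eq b_eq; ring.
by rewrite ltr_wpDr ?addr_ge0 // addr_gt0.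
Qed.

Lemma star_largest_root :
  largest_modulus_root (gamma_poly C q.+2 (#|V| - 7 + 9)) r.
Proof.
have [x x_gt0 xr] := star_perron; have [r_gtq r_gt1] := star_radius_gt.
have [e1 e2 e3 e4 e5] := star_quotient xr.
split; first by apply: (quotient_root e1 e2 e3 e4 e5); rewrite gt_eqF.
move=> z /quotient_vector_eigen z_eig z_neq.
have r_gt0 : 0 < r by apply: lt_trans r_gt1.
rewrite real_ltNge ?normr_real // (gtr0_norm r_gt0); apply/negP => r_le.
pose o : 'I_3 := ord0; pose y := quotient_vector z.
have neq_of (b : C) : `|b| < r -> z != b.
  by move=> b_lt; apply: contraTneq r_le => ->; rewrite lt_geF.
have zq : z - q%:R != 0 by rewrite subr_eq0 neq_of // normr_nat.
have z1 : z + 1 != 0 by rewrite -[1]opprK subr_eq0 neq_of // normrN1.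
have zq1 : z - q%:R + 1 != 0.
  rewrite (_ : z - q%:R + 1 = z - (q%:R - 1)); last by ring.
  rewrite subr_eq0 neq_of //; have [->|q_gt0] := posnP q.
    by rewrite sub0r normrN1.
  (* For positive q the excluded value is the natural number q - 1, which is below r; for q = 0 it
     was -1. *)
  rewrite -[X in _ - X]/(1%:R) -natrB // normr_nat; apply: le_lt_trans r_gtq.
  by rewrite ler_nat leq_subr.
have y_neq0 : y (inl (al o)) != 0 by rewrite /y quotient_vector_al !mulf_neq0.
have zr : `|z| = r.
  apply/eqP; rewrite eq_le r_le andbT.
  exact: (@eigenvalue_le_lambda1 C q.+2 star isT z y _ y_neq0 z_eig).
have abs_eig := norm_eigenvector (isT : (2 <= q.+2)%N) zr z_eig (inl (al o)).
have : `|nbr_sum y (inl (al o))| = nbr_sum (fun u => `|y u|) (inl (al o)).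
  by rewrite z_eig normrM zr -abs_eig.
(* Equality in the triangle inequality gives all neighbours of [al o] a common phase [t]. One of
   them, [be o], has the same value as [al o], so [t] is also the phase there and the eigenvalue
   equation forces z = r. *)
move=> /normC_sum_eq[t _ y_phase].
have al_be_adj : @adjacent star (inl (al o)) (inl (be o)).
  rewrite /adjacent (inj_eq (@inl_inj _ _)) al_be.
  apply/exists_inP; exists (thick_edge (child (c := c) al) (base be (fun=> c)) q (inr o)).
    by rewrite imset_f.
  by rewrite !inl_thick_edge /= !eqxx orbT.
have y_al : y (inl (al o)) = `|y (inl (al o))| * t.
  by have := y_phase _ al_be_adj; rewrite /y quotient_vector_be quotient_vector_al.
case/eqP: z_neq; apply: (mulIf y_neq0); rewrite -z_eig /nbr_sum.
rewrite (eq_bigr _ y_phase) -mulr_suml [X in X * _ = _]abs_eig.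
by rewrite -mulrA -y_al.
Qed.

Lemma star_radius_lt :
  r < (q.+2%:R + 4 + sqrtC ((q.+2%:R + 4) ^+ 2
         + 4 * ((#|V| - 7 + 9)%:R - 3) * (q.+2%:R - 1))) / 2.
Proof.
have [x x_gt0 xr] := star_perron; have [r_gtq _] := star_radius_gt.
have x_ge0 v : 0 <= x v by apply: ltW.
have [e1 e2 e3 e4 e5] := star_quotient xr.
apply: (quotient_bound e1 e2 e3 e4 e5) => //;
  by rewrite sumr_ge0 // => *; rewrite ?addr_ge0 ?sumr_ge0.
Qed.

End Radius.
End StarSpectrum.

(** * Comparison with the star *)

(** Walks are projected to the graph by the invariant [reached]: an added vertex counts as reached
    when some graph vertex of its edge is. *)
Lemma hconnected_power m (G : hypergraph) :
  hconnected (power m G) -> hconnected G.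
Proof.
move=> P_conn x y.
pose meets (e : {set vert G}) := exists2 z, z \in e & connect (@adjacent G) x z.
pose reached (v : power_vert m G) : Prop :=
  match v with inl z => connect (@adjacent G) x z | inr (e, _) => meets (val e) end.
have step (u v : vert (power m G)) : adjacent u v -> reached u -> reached v.
  case/andP=> _ /exists_inP[_ /imsetP[e _ ->] /andP[ue ve]] u_reached.
  have [z ze xz] : meets (val e).
    case: u ue u_reached => [z|[e' t]]; rewrite ?inl_power_edge ?inr_power_edge.
      by exists z.
    by move=> /eqP->.
  case: v ve => [z'|[e' t]]; rewrite ?inl_power_edge ?inr_power_edge.
    move=> z'e /=; have [<-//|zz'] := eqVneq z z'.
    apply: connect_trans xz (connect1 _); rewrite /adjacent zz'.
    by apply/exists_inP; exists (val e); rewrite ?(valP e) // ze.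
  by move=> /eqP-> /=; exists z.
have /connectP[p] := P_conn (inl x) (inl y).
have : reached (inl x) by apply: connect0.
elim: p (inl x : vert (power m G)) => [|v p IHp] u u_reached /=.
  by move=> _ yu; move: u_reached; rewrite -yu.
by case/andP=> /step/(_ u_reached); apply: IHp.
Qed.

Lemma card_power_vert m (G : hypergraph) :
  #|vert (power m G)| = (#|vert G| + #|edges G| * (m - 2))%N.
Proof. by rewrite card_sum card_prod card_ord card_sig. Qed.

Lemma card_power_edges m (G : hypergraph) :
  #|edges (power m G)| = #|edges G|.
Proof. by rewrite card_imset ?card_sig //; apply: power_edge_inj. Qed.

Lemma card_isomorphic H1 H2 : isomorphic H1 H2 ->
  #|vert H1| = #|vert H2| /\ #|edges H1| = #|edges H2|.
Proof.
case=> f f_bij fE; split; first exact: bij_eq_card f_bij.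
by rewrite -fE card_imset //; apply/imset_inj/bij_inj.
Qed.

Lemma chord_ends (G : hypergraph) (G_conn : hconnected G) (c : vert G) :
  uniform 2 G -> #|chords G_conn c| = 3 ->
  {in chords G_conn c &, forall e f : {set vert G}, e != f -> [disjoint e & f]} ->
  exists al be : 'I_3 -> vert G,
    [/\ forall j, al j != c, forall j, be j != c, injective al, injective be
      & forall i j, al i != be j] /\
    forall j, [set al j; be j] \in chords G_conn c.
Proof.
move=> G_graph N3 N_disj.
pose ch (j : 'I_3) := enum_val (cast_ord (esym N3) j).
have ch_in j : ch j \in chords G_conn c by apply: enum_valP.
have ch_inj : injective ch by move=> i j /enum_val_inj /cast_ord_inj.
have : forall j, exists ab : vert G * vert G, (ab.1 != ab.2) && (ch j == [set ab.1; ab.2]).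
  move=> j; have := ch_in j; rewrite inE => /andP[_ /G_graph/eqP/cards2P].
  by case=> x [y [xy ->]]; exists (x, y); rewrite xy eqxx.
case/fin_all_exists => ab abP.
have abE j : ch j = [set (ab j).1; (ab j).2] by case/andP: (abP j) => _ /eqP.
have meet i j x : x \in ch i -> x \in ch j -> i = j.
  move=> xi xj; apply/eqP; rewrite -(inj_eq ch_inj); apply: contraT => ij.
  have := N_disj _ _ (ch_in i) (ch_in j) ij.
  by move/disjointFr/(_ xi); rewrite xj.
have in1 j : (ab j).1 \in ch j by rewrite abE !inE eqxx.
have in2 j : (ab j).2 \in ch j by rewrite abE !inE eqxx orbT.
exists (fun j => (ab j).1), (fun j => (ab j).2); split; last first.
  by move=> j; rewrite -abE.
have ne1 j : (ab j).1 != c.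
  have := ch_in j; rewrite abE => /(chord_connect G_graph)[//].
have ne2 j : (ab j).2 != c.
  have := ch_in j; rewrite abE setUC => /(chord_connect G_graph)[//].
split=> // [i j e|i j e|i j].
- by apply: meet (in1 i) _; rewrite e.
- by apply: meet (in2 i) _; rewrite e.
have [<-|ij] := eqVneq i j; first by case/andP: (abP i).
apply: contraNneq ij => e; apply/eqP; apply: meet (in1 i) _.
by rewrite e.
Qed.

(** * Indexing the edges of the graph by tree children and chords *)

Section TreeIndexing.
Variables (G : hypergraph) (G_conn : hconnected G) (c : vert G).
Variables al be : 'I_3 -> vert G.
Hypotheses (G_graph : uniform 2 G) (card_edges : #|edges G| = (#|vert G| + 2)%N).
Hypotheses (al_inj : injective al) (al_be : forall i j, al i != be j).
Hypothesis chordP : forall j, [set al j; be j] \in chords G_conn c.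

Let p := parent G_conn c.

Lemma tree_index_edge (i : tree_index c) :
  [set child al i; base be p i] \in edges G.
Proof.
case: i => [[v vc]|j] /=.
  by apply: (subsetP (tree_edges_sub G_graph G_conn c)); apply: imset_f; rewrite !inE.
by have := chordP j; rewrite inE => /andP[].
Qed.

Definition edge_of_index (i : tree_index c) : {e | e \in edges G} :=
  Sub [set child al i; base be p i] (tree_index_edge i).

Lemma edge_of_index_inj : injective edge_of_index.
Proof.
have tree_chord (v : {v | v != c}) j :
    [set val v; p (val v)] != [set al j; be j].
  have := chordP j; rewrite inE => /andP[+ _]; apply: contraNneq => <-.
  by apply: imset_f; rewrite !inE (valP v).
case=> [u|i] [v|j] /(congr1 val) /= uv.
- congr inl; apply: val_inj; apply: tree_edge_inj uv; rewrite !inE.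
    exact: (valP u).
  exact: (valP v).
- by case/eqP: (tree_chord u j).
- by case/eqP: (tree_chord v i).
congr inr; apply: al_inj; move/setP: uv => /(_ (al i)).
by rewrite !inE eqxx !(negPf (al_be _ _)) !orbF => /esym/eqP.
Qed.

(** Injectivity suffices, since the tree edges, one fewer than the vertices, and three chords match
    the number of edges. *)
Lemma edge_of_index_bij : bijective edge_of_index.
Proof.
apply: (inj_card_bij edge_of_index_inj).
rewrite card_sum card_ord card_sig card_edges card_sig (cardC1 c).
have : (0 < #|vert G|)%N by apply/card_gt0P; exists c.
lia.
Qed.

End TreeIndexing.

(** Dropping a positive term would lower the sum. It serves to compare the neighbour sums at [c],
    where the star counts every leaf and the tree only the children of [c]. *)
Lemma sum_if_eq (R : numDomainType) (I : finType) (F : I -> R) (P : pred I) :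
  (forall i, 0 < F i) -> \sum_i F i = \sum_i (if P i then F i else 0) ->
  forall i, P i.
Proof.
move=> F_gt0; rewrite -big_mkcond (bigID P) /= -[RHS]addr0 => /addrI sum0 i.
apply: contraT => Pi; have := F_gt0 i.
have /psumr_eq0P-> // := sum0; last by move=> j _; apply: ltW.
by rewrite ltxx.
Qed.

Lemma thick_le_star (C : numClosedFieldType) (V : finType) (c : V) (q : nat)
    (al be : 'I_3 -> V) (p : V -> V)
    (x : V + tree_index c * 'I_q -> C) :
  let a := child (c := c) al in
  let b := base (c := c) be p in
  let b' := base (c := c) be (fun=> c) in
  (forall j, al j != c) -> (forall j, be j != c) -> injective al ->
  (forall i j, al i != be j) ->
  (forall i, a i != b i) -> injective (fun i => [set a i; b i]) ->
  (forall v, 0 < x v) -> (forall v, x (inl v) <= x (inl c)) ->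
  (forall v, nbr_sum (H := thick a b q) x v =
     (q.+2%:R - 1) * lambda1 C q.+2 (thick a b q) * x v) ->
  lambda1 C q.+2 (thick a b q) <= lambda1 C q.+2 (thick a b' q) /\
  (lambda1 C q.+2 (thick a b q) = lambda1 C q.+2 (thick a b' q) ->
   forall v, v != c -> p v = c).
Proof.
move=> a b b' al_neq be_neq al_inj al_be ab_neq ab_inj x_gt0 x_max x_eig.
have m_ge2 : (2 <= q.+2)%N by [].
have x_ge0 v : 0 <= x v by apply: ltW.
have b'_neq : forall i, a i != b' i := star_neq al_be.
have b'_inj : injective (fun i => [set a i; b' i]) := star_inj al_neq be_neq al_inj al_be.
have form_le : \sum_v x v * nbr_sum (H := thick a b q) x v <=
    \sum_v x v * nbr_sum (H := thick a b' q) x v.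
  by apply: thick_form_le => // -[u|j] /=.
have form_eq : \sum_v x v * nbr_sum (H := thick a b q) x v =
    (q.+2%:R - 1) * lambda1 C q.+2 (thick a b q) * \sum_v x v ^+ 2.
  by rewrite mulr_sumr; apply: eq_bigr => v _; rewrite x_eig expr2 mulrCA.
have form_star := nbr_sum_rayleigh (H := thick a b' q) m_ge2 x_ge0.
have sq_gt0 : 0 < \sum_v x v ^+ 2.
  rewrite (bigD1 (inl c)) //= ltr_wpDr ?exprn_gt0 // sumr_ge0 // => v _.
  by rewrite exprn_ge0.
split.
  have := le_trans form_le form_star; rewrite form_eq.
  move: (lambda1 _ _ _) (lambda1 _ _ _) (\sum_v x v ^+ 2) sq_gt0 => l l' sq sq_gt0.
  by rewrite ler_pM2r // ler_pM2l ?uniformity_gt0.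
move=> lambda_eq v vc; apply: contraTeq isT => pv.
have form_star_eq : \sum_v x v * nbr_sum (H := thick a b' q) x v =
    (q.+2%:R - 1) * lambda1 C q.+2 (thick a b' q) * \sum_v x v ^+ 2.
  by apply: le_anti; rewrite form_star -lambda_eq -form_eq.
(* Equality in the Rayleigh bound makes [x] an eigenvector of the star as well, with the same
   eigenvalue. *)
have star_eig : nbr_sum (H := thick a b' q) x (inl c)
    = nbr_sum (H := thick a b q) x (inl c).
  apply: etrans (esym (x_eig (inl c))); rewrite lambda_eq.
  exact: (nbr_sum_rayleigh_eq (H := thick a b' q) m_ge2 x_ge0 form_star_eq).
move: star_eig; rewrite (star_center al_neq be_neq al_inj al_be).
rewrite (nbr_sum_thick_inl ab_neq ab_inj).
rewrite [RHS]big_mkcond big_sumType /= [X in _ = _ + X]big1 ?addr0; last first.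
  by move=> j _; rewrite !(eq_sym c) (negPf (al_neq j)) (negPf (be_neq j)).
set w := fun u : {v | v != c} => x (inl (val u)) + \sum_t x (inr (inl u, t)).
have w_gt0 u : 0 < w u by rewrite ltr_wpDr ?sumr_ge0.
rewrite [RHS](eq_bigr (fun u : {v | v != c} => if p (val u) == c then w u else 0)).
  by move=> /(sum_if_eq w_gt0)/(_ (Sub v vc)); rewrite (negPf pv).
move=> u _; rewrite (eq_sym c) (negPf (valP u)) (eq_sym c) /=.
case: eqP => [pu|_]; last exact: erefl.
rewrite /w pu; ring.
Qed.

Theorem theorem5p2p1 (C : numClosedFieldType) (m k : nat) (H : hypergraph)
    (m_ge2 : (2 <= m)%N)
    (H_power : power_hypergraph m H)
    (H_connected : hconnected H)
    (H_uniform : uniform m H)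
    (H_linear : linear_hypergraph H)
    (H_3cyclic : three_cyclic H)
    (H_typeII : type_II m H)
    (H_edges : #|edges H| = k) :
  let T := T2C m (only_c1 (k - 9)) in
  (lambda1 C m H <= lambda1 C m T
   /\ (lambda1 C m H = lambda1 C m T -> isomorphic H T))
  /\
  (exists gamma : C,
    [/\ largest_modulus_root (gamma_poly C m k) gamma,
        lambda1 C m T = gamma / (m%:R - 1)
      & gamma < (m%:R + 4
                 + sqrtC ((m%:R + 4) ^+ 2 + 4 * (k%:R - 3) * (m%:R - 1))) / 2]).
Proof.
have [G G_graph isoH] := H_power.
have P_conn := hconnected_isomorphic isoH H_connected.
have G_conn := hconnected_power P_conn.
have [card_vH card_eH] := card_isomorphic isoH.
move: card_vH card_eH; rewrite card_power_vert card_power_edges H_edges.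
(* Removing the m - 2 added vertices of each edge from n = k(m - 1) - 2 leaves k - 2 graph
   vertices. *)
move=> card_vH card_eH; have card_G : #|edges G| = (#|vert G| + 2)%N.
  move: H_typeII; rewrite /type_II card_vH H_edges card_eH.
  have -> : (m - 1 = (m - 2).+1)%N by lia.
  rewrite mulnS; lia.
have [v0 _] : exists v : vert G, true.
  have : (0 < #|edges G|)%N by rewrite card_G addn2.
  case/card_gt0P => e eG; have : (0 < #|e|)%N by rewrite G_graph.
  by case/card_gt0P => v _; exists v.
have [q mq] : exists q, m = q.+2 by exists (m - 2)%N; lia.
subst m; have [x0 [x0_ge0 x0_neq0 x0_eig]] :=
  perron_vector C m_ge2 (inl v0 : vert (power q.+2 G)).
have x0_gt0 := perron_vector_gt0 P_conn x0_ge0 x0_neq0 x0_eig.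
pose xV v := x0 (inl v).
(* The maximum is taken over graph vertices only, and [real_arg_maxP] applies because the values are
   real. *)
have [c x_max] : exists c, forall v, xV v <= xV c.
  have xV_real : {in xpredT, forall v, xV v \is Num.real}.
    by move=> v _; apply/ger0_real/x0_ge0.
  by case: (real_arg_maxP (i0 := v0) isT xV_real) => c _ c_max; exists c => v; apply: c_max.
have card_chord : #|chords G_conn c| = 3.
  have : (0 < #|vert G|)%N by apply/card_gt0P; exists c.
  by rewrite card_chords // card_G; lia.
have [al [be [[al_neq be_neq al_inj be_inj al_be] chordP]]] : _ :=
  chord_ends G_graph card_chord
    (chords_disjoint G_graph isoH H_3cyclic (eq_leq (esym card_chord))).
have h_bij := edge_of_index_bij G_graph card_G al_inj al_be chordP.
pose p := parent G_conn c; pose a := child (c := c) al.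
pose b := base (c := c) be p; pose b' := base (c := c) be (fun=> c).
have q_eq : q = (q.+2 - 2)%N by rewrite subn2.
have [f [f_bij f_inl fE]] := power_thick q_eq h_bij (fun=> erefl).
have iso_thick : isomorphic (thick a b q) (power q.+2 G) by exists f.
have lambda_thick : lambda1 C q.+2 (power q.+2 G) = lambda1 C q.+2 (thick a b q).
  exact: esym (lambda1_isomorphic C m_ge2 (inl c : vert (thick a b q)) iso_thick).
have ab_neq i : a i != b i := set2_edge G_graph (tree_index_edge G_graph chordP i).
have ab_inj : injective (fun i => [set a i; b i]).
  by move=> i j ij; apply: (bij_inj h_bij); apply: val_inj.
have [] := @thick_le_star C (vert G) c q al be p (fun v => x0 (f v))
  al_neq be_neq al_inj al_be ab_neq ab_inj.
- by move=> v; apply: x0_gt0.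
- by move=> v; rewrite !f_inl; apply: x_max.
- move=> v; rewrite -lambda_thick -x0_eig.
  exact: (nbr_sum_isomorphic x0 v f_bij fE).
rewrite -/a -/b -/b' => le_star eq_star.
have k_eq : (k - 9 = #|vert G| - 7)%N by rewrite card_eH card_G; lia.
have card_V := card_outer al_neq be_neq al_inj be_inj al_be.
(* [card_outer] supplies at least seven vertices, so the truncated subtractions are exact. *)
have k_eq9 : k = (#|vert G| - 7 + 9)%N by rewrite card_eH card_G -card_V; lia.
have T_star : isomorphic (T2C q.+2 (only_c1 (k - 9))) (thick a b' q).
  have := T2C_star al_neq be_neq al_inj be_inj al_be m_ge2.
  by rewrite k_eq -q_eq.
have lambda_H : lambda1 C q.+2 H = lambda1 C q.+2 (thick a b q).
  rewrite -lambda_thick; apply: esym.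
  exact: (lambda1_isomorphic C m_ge2 (inl v0 : vert (power q.+2 G)) (isomorphic_sym isoH)).
have lambda_T : lambda1 C q.+2 (T2C q.+2 (only_c1 (k - 9))) = lambda1 C q.+2 (thick a b' q).
  by apply: lambda1_isomorphic T_star => //; exact: (inl ord0).
rewrite /= lambda_H lambda_T; split.
  split=> // /eq_star p_eq; apply: isomorphic_trans isoH _.
  apply: isomorphic_trans (isomorphic_sym T_star); apply: isomorphic_sym.
  (* Once every parent is [c], the indexing of the edges of G is also that of the star, and the
     power of G is the star itself. *)
  have hE i : val (edge_of_index G_graph chordP i) = [set a i; b' i].
    case: i => [u|j] //=; congr [set _; _].
    by apply: p_eq; apply: (valP u).
  by have [g [g_bij _ gE]] := power_thick q_eq h_bij hE; exists g.
exists ((q.+2%:R - 1) * lambda1 C q.+2 (thick a b' q)); split.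
- by rewrite k_eq9; apply: star_largest_root.
- by rewrite mulrC mulKf // gt_eqF ?uniformity_gt0.
by rewrite k_eq9; apply: star_radius_lt.
Qed.
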